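(* For all $\Delta\in\mathbb{N}$ and $\alpha>0$ there exists $n_0$ such that every digraph $G$ of order $n\ge n_0$ with $\delta^0(G)\ge \bigl(\tfrac12+\alpha\bigr)n$ contains every oriented tree $T$ of order $n$ with $\Delta(T)\le\Delta$.
   Context: A digraph has no loops and at most one edge in each direction between two vertices. $\delta^0(G)$ (minimum semidegree) is the minimum over all vertices $x$ of $\min\{\deg^+_G(x),\deg^-_G(x)\}$. An oriented tree is an orientation of a tree (each edge $\{u,v\}$ replaced by exactly one of $(u,v)$, $(v,u)$); $\Delta(T)$ is the maximum degree of the underlying undirected tree. ''$G$ contains $T$'' means $G$ has a subdigraph isomorphic to $T$ (here necessarily spanning). *)

(* Defs.v *)
From mathcomp Require Import all_boot all_order all_algebra.
From mathcomp Require Import reals.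

Set Implicit Arguments.
Unset Strict Implicit.
Unset Printing Implicit Defensive.

(* A digraph on V is an irreflexive relation g : rel V, where g x y means that
   (x, y) is an edge; g x y and g y x may both hold. *)
Section Digraph.
Variables (V : finType) (g : rel V).

Definition digraph : Prop := irreflexive g.

Definition outdeg (x : V) : nat := #|[set y | g x y]|.
Definition indeg (x : V) : nat := #|[set y | g y x]|.

(* No degree exceeds #|V|, so the neutral value #|V| does not affect the
   minimum as soon as V is nonempty. *)
Definition min_semidegree : nat :=
  \big[minn/#|V|]_(x : V) minn (outdeg x) (indeg x).

Definition subdigraph (S : {set V}) (h : rel V) : Prop :=
  forall x y, h x y -> [/\ x \in S, y \in S & g x y].

End Digraph.

Definition isomorphic_to (V W : finType) (S : {set V}) (h : rel V)
    (t : rel W) : Prop :=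
  exists f : W -> V,
    [/\ injective f, [set f x | x : W] = S & forall x y, h (f x) (f y) = t x y].

Definition contains (V W : finType) (g : rel V) (t : rel W) : Prop :=
  exists (S : {set V}) (h : rel V), subdigraph g S h /\ isomorphic_to S h t.

Section UndirectedGraph.
Variables (W : finType) (e : rel W).

Definition simple_graph : Prop := symmetric e /\ irreflexive e.

Definition connected_graph : Prop := 0 < #|W| /\ forall x y, connect e x y.

(* Duplicate-free closed e-paths of length 1 or 2 are a loop or a single edge
   traversed back and forth, so only length at least 3 gives a graph cycle. *)
Definition acyclic : Prop := forall c : seq W, 2 < size c -> ~ ucycle e c.

Definition tree : Prop := [/\ simple_graph, connected_graph & acyclic].

Definition max_degree : nat := \max_(x : W) #|[set y | e x y]|.

End UndirectedGraph.

Definition underlying (W : finType) (t : rel W) : rel W :=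
  [rel x y | t x y || t y x].

(* For x = y the first condition says that t has no loops. *)
Definition oriented_tree (W : finType) (t : rel W) : Prop :=
  (forall x y, ~~ (t x y && t y x)) /\ tree (underlying t).

(* Main.v *)
Require Import Defs.
From mathcomp Require Import all_boot all_order all_algebra.
From mathcomp Require Import reals sequences exp.
From mathcomp Require Import zify ring lra.
Set Implicit Arguments.
Unset Strict Implicit.
Unset Printing Implicit Defensive.
Import Order.TTheory GRing.Theory Num.Theory.

(* Order the vertices of the tree so that every vertex comes after its parent
   and every initial segment has only O(log n) children outside it.  The tree
   is then embedded along this order in three phases.

   (1) A short initial segment is placed greedily so as to create absorbers: for
   all vertices x, v of the digraph there are linearly many embedded tree
   vertices b of degree at most 2 whose image is a neighbour of x and may be
   replaced by v.  Any two neighbourhoods share 2 alpha n vertices, so a random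
   choice creates such absorbers, and the method of conditional expectations
   makes the choice deterministic.

   (2) The bulk of the tree is placed in epochs of O(log n) vertices, keeping
   every vertex adjacent to more than half of the unused set U.  The digraph
   induced on U carries a doubly stochastic kernel that is bounded below on all
   edges; its random walk is uniform on average and mixes in O(1) steps, so an
   epoch can be placed at nearly the average cost with respect to any cost
   function on U.  The cost function is the gradient of the exponential
   potential sum_v exp (- lambda d_U(v) / |U|).

   (3) Each remaining tree vertex, with parent at x, takes the image of an
   absorber for x and some unused v, which moves to v. *)

(** * Ordering a bounded-degree tree *)

(** The kernel exists only while every vertex sees more than half of [U], so all [2 * #|V|]
    densities must be controlled together while the bulk is placed. A potential with [lambda] of
    order log n does this: a single low density would already make it too large. A tree vertex whose
    parent precedes the epoch starts its walk at an uncontrolled place and pays a bounded excess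
    until the walk has mixed. The order keeps the number of such vertices at O(log n), and an epoch
    longer by a large constant factor makes their total excess negligible. The walk also has to
    avoid the vertices used since the start of the epoch, which is cheap only while [U] is much
    larger than the square of the epoch length. The bulk stops with a constant fraction of the
    vertices left. This fraction is dictated by the absorbers: a swap uses up its absorber, so every
    pair needs as many absorbers as there are vertices left. Their number depends on alpha and Delta
    only, and the precision of the epochs is chosen afterwards to suit the resulting fraction. *)

Section TreeOrder.
Variables (W : finType) (e : rel W) (Delta : nat).
Hypothesis e_sym : symmetric e.
Hypothesis e_irr : irreflexive e.
Hypothesis e_acyclic : acyclic e.
Hypothesis e_deg : forall x, #|[set y | e x y]| <= Delta.

Definition restr (C : {set W}) : rel W := [rel x y | [&& e x y, x \in C & y \in C]].

Definition connected_in (C : {set W}) : Prop :=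
  forall x y, x \in C -> y \in C -> connect (restr C) x y.

Lemma restr_sym C : connect_sym (restr C).
Proof.
apply: sym_connect_sym => x y.
by rewrite /restr /= e_sym; case: (x \in C); case: (y \in C).
Qed.

Lemma path_restr C x p : path (restr C) x p -> path e x p /\ all [in C] p.
Proof.
elim: p x => //= y p IH x /andP[/and3P[-> _ yC] /IH[-> ->]].
by rewrite yC.
Qed.

Lemma restr_path (C : {set W}) x p : x \in C -> all [in C] p -> path e x p -> path (restr C) x p.
Proof.
elim: p x => //= y p IH x xC /andP[yC pC] /andP[exy ep].
by rewrite /restr /= exy xC yC; apply: IH.
Qed.

(** Two distinct neighbours of [r], a simple path joining them inside [C], and [r] itself would form
    a cycle of length at least 3. *)
Lemma unique_neighbour (C : {set W}) r x y : connected_in C -> r \notin C -> x \in C ->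
  y \in C -> e r x -> e r y -> x = y.
Proof.
move=> cC rC xC yC erx ery; apply/eqP/negPn/negP => xy.
have /connectP[p0 pp0 yE0] := cC _ _ xC yC.
move: yE0; case/shortenP: pp0 => p pp up _ yE.
have [ep pC] := path_restr pp.
apply: (e_acyclic (c := r :: x :: p)) => /=.
  by case: p yE {pp up ep pC} => //= yE; rewrite yE eqxx in xy.
rewrite /ucycle /= erx rcons_path ep -yE e_sym ery /=.
rewrite -[_ && uniq p]/(uniq (x :: p)) up andbT inE negb_or.
have -> /= : r != x by apply: contraNneq rC => ->.
by apply: contra rC => /(allP pC).
Qed.

(* The smallest branch at the root goes first: entering a branch that is not
   the last one halves the size and leaves at most [Delta] vertices pending. *)
Lemma order_exists (S : {set W}) (r : W) : r \in S -> connected_in S ->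
  exists s : seq W,
    [/\ uniq (r :: s), r :: s =i S,
        forall i, 0 < i < (size s).+1 ->
          has (e (nth r (r :: s) i)) (take i (r :: s)) &
        forall a, 0 < a ->
          count (fun y => has (e y) (take a (r :: s))) (drop a (r :: s))
            <= Delta * (trunc_log 2 #|S|).+1].
Proof.
have [m] := ubnP #|S|; elim: m S r => // m IHm S r leSm rS cS.
pose A := S :\ r.
pose comp x := [set y in A | connect (restr A) x y].
pose nb := [set x in S | e r x].
have nbA x : x \in nb -> x \in A.
  rewrite !inE => /andP[-> erx]; rewrite andbT.
  by apply: contraTneq erx => ->; rewrite e_irr.
have A_S x : x \in A -> x \in S by rewrite !inE => /andP[].
have rootP y : y \in A -> exists x p, [/\ x \in nb, path (restr A) x p & y = last x p].
  move=> yA; have /connectP[p0 pp0 yE0] := cS _ _ rS (A_S _ yA).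
  move: yE0; case/shortenP: pp0 => -[|x p] pp up _ /= yE.
    by move: yA; rewrite yE !inE eqxx.
  have [/= /andP[erx ep] /andP[xS pS]] := path_restr pp.
  have xA : x \in nb by rewrite inE xS.
  exists x, p; split => //; apply: restr_path => //; first exact: nbA.
  apply/allP => z zp; rewrite !inE (allP pS _ zp) andbT.
  by apply: contraTneq up => <-; rewrite /= inE zp orbT.
have [nb0|[x0 x0nb]] := set_0Vmem nb.
  have S1 y : y \in S -> y = r.
    move=> yS; apply/eqP/negPn/negP => yr.
    have yA : y \in A by rewrite !inE yr.
    by have [x [p [+ _ _]]] := rootP y yA; rewrite nb0 inE.
  exists [::]; split => //=.
  - by move=> y; rewrite inE; apply/eqP/idP => [->|/S1].
  - by move=> [|i].
  - by move=> [|a].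
pose x := [arg min_(x < x0 in nb) #|comp x|].
have [xnb xmin] : x \in nb /\ forall y, y \in nb -> #|comp x| <= #|comp y|.
  by rewrite /x; case: arg_minnP.
have xA := nbA _ xnb.
have erx : e r x by move: xnb; rewrite inE => /andP[].
have compA y z : z \in comp y -> z \in A by rewrite inE => /andP[].
have comp_refl y : y \in A -> y \in comp y by move=> yA; rewrite inE yA connect0.
have comp_path y z p : y \in A -> z \in comp y -> path (restr A) z p ->
    all [in comp y] p.
  move=> yA; elim: p z => //= w p IH z; rewrite inE => /andP[zA yz] /andP[zw pp].
  have wC : w \in comp y.
    rewrite inE (connect_trans yz (connect1 zw)) andbT.
    by move: zw => /and3P[].
  by rewrite /= wC; apply: IH wC pp.
have comp_conn y : y \in A -> connected_in (comp y).
  move=> yA u v uC vC.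
  have uv : connect (restr A) u v.
    move: uC vC; rewrite !inE => /andP[_ yu] /andP[_ yv].
    by apply: connect_trans yv; rewrite restr_sym.
  have /connectP[p pp ->] := uv; apply/connectP; exists p => //.
  by apply: restr_path => //; [apply: comp_path uC pp | case: (path_restr pp)].
have comp_edge y u v : y \in A -> u \in comp y -> v \in A -> e u v -> v \in comp y.
  move=> yA uC vA euv.
  have := @comp_path y u [:: v] yA uC.
  by rewrite /restr /= euv (compA _ _ uC) vA => /(_ isT) /andP[].
have comp_nb y z : y \in nb -> z \in comp y -> e r z -> z = y.
  move=> ynb zC erz; have yA := nbA _ ynb.
  apply: (unique_neighbour (comp_conn y yA) (r := r)) => //.
  - by apply/negP => /compA; rewrite !inE eqxx.
  - exact: comp_refl.
  - by move: ynb; rewrite inE => /andP[].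
pose C := comp x; pose S' := S :\: C.
have rC : r \notin C by apply/negP => /compA; rewrite !inE eqxx.
have rS' : r \in S' by rewrite in_setD rC.
have C_S : C \subset S by apply/subsetP => z /compA/A_S.
have cS' : connected_in S'.
  suff H y : y \in S' -> connect (restr S') r y.
    by move=> y z /H yr /H; apply: connect_trans; rewrite restr_sym.
  have [->|yr yS'] := eqVneq y r; first by rewrite connect0.
  move: (yS'); rewrite in_setD => /andP[yC yS].
  have yA : y \in A by rewrite !inE yr.
  have [z [p [znb pp yE]]] := rootP _ yA.
  have [ep pA] := path_restr pp.
  have memC w : w \in z :: p -> w \notin C.
    move=> wp; apply: contra yC => wC.
    case/splitPl: wp pp yE {ep pA} => p1 p2 lw; rewrite cat_path last_cat lw.
    move=> /andP[_ pp2] ->.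
    case/lastP: p2 pp2 => //= p2 w' /(comp_path _ _ _ xA wC)/allP; apply.
    by rewrite last_rcons mem_rcons inE eqxx.
  apply/connectP; exists (z :: p) => //; apply: restr_path => //=.
    rewrite !in_setD memC ?inE ?eqxx //= (A_S _ (nbA _ znb)) /=.
    apply/allP => w wp; rewrite /= in_setD memC ?inE ?wp ?orbT //=.
    exact: (A_S _ (allP pA _ wp)).
  by move: znb; rewrite inE => /andP[_ ->].
have C_gt0 : 0 < #|C| by apply/card_gt0P; exists x; apply: comp_refl.
have cardS : #|S'| + #|C| = #|S|.
  by rewrite cardsD (setIidPr C_S) subnK // subset_leq_card.
have S'_gt0 : 0 < #|S'| by apply/card_gt0P; exists r.
have leC : #|C| < m by lia.
have leS' : #|S'| < m by lia.
have [s1 [u1 m1 p1 b1]] := IHm C x leC (comp_refl _ xA) (comp_conn _ xA).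
have [s2 [u2 m2 p2 b2]] := IHm S' r leS' rS' cS'.
have s2S' z : z \in s2 -> z \in S' /\ z != r.
  move=> zs; rewrite -m2 inE zs orbT; split => //.
  by apply: contraTneq zs => ->; case/andP: u2.
have s2A z : z \in s2 -> z \in A.
  by move=> /s2S'[]; rewrite !in_setD inE => /andP[_ ->] ->.
have s2C z : z \in s2 -> z \notin C by move=> /s2S'[]; rewrite in_setD => /andP[].
have no_edge y z : y \in s2 -> z \in C -> e y z = false.
  move=> ys zC; apply/negP => eyz; move/negP: (s2C _ ys); apply.
  by apply: comp_edge zC (s2A _ ys) _ => //; rewrite e_sym.
have no_edges y p : y \in s2 -> {subset p <= x :: s1} -> has (e y) p = false.
  by move=> ys ps; apply/hasPn => z /ps; rewrite m1 => zC; rewrite no_edge.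
(* [r] heads both the order of [S] and that of [S']; the order of the branch [C] is inserted between
   [r] and the tail [s2]. *)
exists ((x :: s1) ++ s2); split.
- rewrite cons_uniq cat_uniq u1 mem_cat negb_or m1 rC /=.
  move: u2; rewrite cons_uniq => /andP[-> ->]; rewrite andbT /=.
  by apply/hasPn => z zs; rewrite /= m1; apply: s2C.
- move=> z; rewrite inE mem_cat m1 orbCA.
  have := m2 z; rewrite inE => ->; rewrite in_setD.
  by case zC: (z \in C) => //=; rewrite (subsetP C_S).
- move=> [//|i] /andP[_]; rewrite ltnS size_cat => lti.
  rewrite -[nth _ _ _]/(nth r ((x :: s1) ++ s2) i).
  rewrite -[take _ _]/(r :: take i ((x :: s1) ++ s2)) nth_cat take_cat; case: ltnP => [lt1|ge1].
    case: i lt1 {lti} => [|i] lt1; first by rewrite /= e_sym erx.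
    have := p1 i.+1; rewrite -[_ && _]/(i.+1 < size (x :: s1)) lt1 => /(_ isT).
    rewrite (set_nth_default x) // => H.
    by apply/orP; right.
  have lt2 : 0 < (i - size (x :: s1)).+1 < (size s2).+1.
    by move: lti ge1; clear; lia.
  have /orP[h|h] := p2 _ lt2; apply/orP; first by left.
  right; rewrite -[X in is_true X]/(has _ ((x :: s1) ++ _)) has_cat; apply/orP; right.
  exact: h.
move=> [//|a] _ /=; rewrite -[x :: s1 ++ s2]/((x :: s1) ++ s2) take_cat drop_cat.
have nbC : #|[set y in nb | y \in s2]| + 1 <= #|nb|.
  rewrite addn1; apply: proper_card; apply/properP; split.
    by apply/subsetP => z; rewrite inE => /andP[].
  exists x => //; rewrite inE xnb /=; apply/negP => /s2C.
  by rewrite /C comp_refl.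
have nbD : #|nb| <= Delta.
  apply: leq_trans (e_deg r); apply: subset_leq_card.
  by apply/subsetP => z; rewrite !inE => /andP[].
have count_s2 : count (e^~ r) s2 = #|[set y in nb | y \in s2]|.
  rewrite -size_filter -(card_uniqP _) ?filter_uniq //; last by case/andP: u2.
  apply: eq_card => z; rewrite mem_filter !inE e_sym.
  by case zs: (z \in s2); rewrite ?andbF // !andbT (A_S _ (s2A _ zs)).
(* A prefix that ends beyond [C] has the pending vertices of a prefix of the order of [S'], since no
   edge joins [s2] to [C]. A prefix that ends inside [C] has pending vertices in [C] and, besides
   them, the other neighbours of [r]. *)
case: ltnP => [lt1|ge1]; last first.
  apply: leq_trans (_ : Delta * (trunc_log 2 #|S'|).+1 <= _).
    apply: leq_trans (b2 (a - size (x :: s1)).+1 isT).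
    rewrite /= leq_eqVlt; apply/orP; left; apply/eqP/eq_in_count => y yd /=.
    have ys2 : y \in s2 by apply: mem_drop yd.
    by rewrite -[e y x || _]/(has (e y) ((x :: s1) ++ _)) has_cat (no_edges y (x :: s1)).
  by rewrite leq_mul2l ltnS leq_trunc_log ?orbT // -cardS leq_addr.
rewrite count_cat.
have -> : count (fun y => e y r || has (e y) (take a (x :: s1))) s2 = #|[set y in nb | y \in s2]|.
  rewrite -count_s2; apply: eq_in_count => y ys.
  by rewrite no_edges ?orbF // => z /mem_take.
case: a lt1 => [|a] lt1.
  rewrite take0 drop0 (@eq_in_count _ _ (pred1 x)); last first.
    move=> y ys; rewrite orbF /=; apply/idP/eqP => [|->]; last by rewrite e_sym.
    by rewrite e_sym; apply: comp_nb => //; rewrite -/C -m1.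
  rewrite count_uniq_mem // inE eqxx /=.
  by rewrite mulnS addnC (leq_trans (leq_trans nbC nbD)) // leq_addr.
rewrite (@eq_in_count _ _ (fun y => has (e y) (take a.+1 (x :: s1)))); last first.
  move=> y yd; suff -> : e y r = false by [].
  apply/negP; rewrite e_sym => /comp_nb -/(_ _ xnb) yx.
  have yC : y \in C by rewrite -m1; apply: mem_drop yd.
  move: u1; rewrite -(cat_take_drop a.+1 (x :: s1)) cat_uniq => /and3P[_ + _].
  move=> /hasPn/(_ _ yd); rewrite yx //= inE eqxx.
  by [].
have := b1 a.+1 isT.
have [nb1|nb2] := leqP #|nb| 1.
  have -> : #|[set y in nb | y \in s2]| = 0 by move: nbC nb1; clear; lia.
  rewrite addn0 => H; apply: leq_trans H _.
  by rewrite leq_mul2l ltnS leq_trunc_log ?orbT // -cardS leq_addl.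
move=> H.
have : 2 * #|C| <= #|S|.
  have /card_gt0P[y] : 0 < #|nb :\ x| by have := cardsD1 x nb; rewrite xnb; move: nb2; clear; lia.
  rewrite in_setD1 => /andP[yx ynb].
  have yA := nbA _ ynb.
  have dis : comp x :&: comp y = set0.
    apply/setP => z; rewrite in_setI in_set0; apply/negP => /andP[zx zy].
    case/negP: yx; apply/eqP; symmetry; apply: comp_nb => //; rewrite inE xA /=.
    move: zx zy; rewrite !inE => /andP[_ zx] /andP[_ zy].
    by apply: connect_trans zy _; rewrite restr_sym.
  have : #|comp x :|: comp y| <= #|S|.
    apply: subset_leq_card; apply/subsetP => z; rewrite in_setU.
    by case/orP => /compA/A_S.
  rewrite cardsU dis cards0 subn0.
  by have := xmin _ ynb; rewrite /C; clear; lia.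
move=> /(leq_trunc_log 2); rewrite trunc_logMp // => H2.
have : Delta * (trunc_log 2 #|C|).+2 <= Delta * (trunc_log 2 #|S|).+1.
  by rewrite leq_mul2l ltnS H2 orbT.
apply: leq_trans; rewrite [leqRHS]mulnS addnC; apply: leq_add => //.
by apply: leq_trans nbD; apply: leq_trans nbC; apply: leq_addr.
Qed.
End TreeOrder.

(* [pi i] is the parent of the [i]-th vertex; the entry [pi 0] is junk. *)
Definition parent_array (Delta L n : nat) (pi : nat -> nat) : Prop :=
  [/\ forall i, 0 < i < n -> pi i < i,
      forall i, count (fun j => pi j == i) (index_iota 1 n) <= Delta &
      forall a, 0 < a -> count (fun j => pi j < a) (index_iota a n) <= L].

(** The parent of a vertex is its first neighbour in the order. Prefixes are connected, so
    acyclicity makes it the only earlier neighbour, and every tree edge joins a vertex to its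
    parent. [sg i] is true when this edge points from the parent to [i]. *)
Lemma oriented_tree_parent_array (W : finType) (t : rel W) (Delta : nat) :
  oriented_tree t -> max_degree (underlying t) <= Delta ->
  exists (w : nat -> W) (pi : nat -> nat) (sg : nat -> bool),
    [/\ forall i j, i < #|W| -> j < #|W| -> w i = w j -> i = j,
        forall x, exists2 i, i < #|W| & w i = x,
        parent_array Delta (Delta * (trunc_log 2 #|W|).+1) #|W| pi &
        forall i j, i < #|W| -> j < #|W| -> t (w i) (w j) ->
          [/\ 0 < j, pi j = i & sg j] \/ [/\ 0 < i, pi i = j & ~~ sg i]].
Proof.
move=> [t_anti [[e_sym e_irr] [W_gt0 e_conn] e_ac]] degW.
set e := underlying t in e_sym e_irr e_conn e_ac degW.
have e_deg x : #|[set y | e x y]| <= Delta.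
  by apply: leq_trans degW; rewrite /max_degree (bigop.bigmax_sup x).
have [r _] := card_gt0P W_gt0.
have connT : connected_in e [set: W].
  move=> x y _ _; rewrite (eq_connect (e' := e)) // => u v.
  by rewrite /restr /= !inE !andbT.
have [s0 [us ms ps bs]] := order_exists e_sym e_irr e_ac e_deg (in_setT r) connT.
pose s := r :: s0; pose w := nth r s; pose pi i := find (e (w i)) s.
rewrite -/s in us ms ps bs.
have sizes : size s = #|W|.
  by rewrite -(card_uniqP us); apply: eq_card => x; rewrite ms !inE.
rewrite -[(size s0).+1]/(size s) sizes in ps.
clearbody s.
have pi_lt i : 0 < i < #|W| -> pi i < i.
  move=> iW; have := ps i iW.
  rewrite has_find size_take_min -/(w i) /pi => H.
  have [i0 iW'] := andP iW.
  rewrite -[s in find _ s](cat_take_drop i) find_cat has_find size_take_min H.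
  by apply: leq_trans H (geq_minl _ _).
have e_pi i : 0 < i < #|W| -> e (w i) (w (pi i)).
  move=> iW; apply: nth_find; rewrite has_find sizes -/(pi i).
  by have := pi_lt i iW; lia.
have wI i j : i < #|W| -> j < #|W| -> w i = w j -> i = j.
  by move=> iW jW /eqP; rewrite nth_uniq ?sizes // => /eqP.
have w_take i a : i < a -> a <= #|W| -> w i \in take a s.
  by move=> ia aW; rewrite /w -(nth_take _ ia) mem_nth // size_take_min sizes; lia.
have take_w x a : x \in take a s -> exists i, [/\ i < a, i < #|W| & x = w i].
  move=> /(nthP r)[i]; rewrite size_take_min sizes leq_min => /andP[ia iW] <-.
  by exists i; rewrite nth_take.
have prefix_conn a : 0 < a <= #|W| -> connected_in e [set x in take a s].
  elim: a => [//|a IHa] aW.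
  suff H y : y \in [set x in take a.+1 s] ->
      connect (restr e [set x in take a.+1 s]) (w 0) y.
    move=> x y /H h1 /H; apply: connect_trans; rewrite restr_sym //.
  rewrite inE => /take_w[i [ia iW ->]].
  have [i0|i0] := posnP i; first by rewrite i0 connect0.
  have sub z : z \in take a s -> z \in take a.+1 s.
    by rewrite -[take a s](take_takel s (leqnSn a)) => /mem_take.
  have a0 : 0 < a by lia.
  have w0a : w 0 \in [set x in take a s] by rewrite inE w_take //; lia.
  have old j : j < a -> connect (restr e [set x in take a.+1 s]) (w 0) (w j).
    move=> ja; apply: (connect_sub (e := restr e [set x in take a s])).
      move=> u v /and3P[uv]; rewrite !inE => /sub ua /sub va.
      by apply: connect1; rewrite /restr /= uv !inE ua va.
    by apply: IHa; rewrite ?inE ?w_take //; lia.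
  have [ia'|ia'] := ltnP i a; first exact: old.
  have ii : 0 < i < #|W| by lia.
  have lt := pi_lt i ii.
  apply: connect_trans (old (pi i) _) (connect1 _); first by lia.
  by rewrite /restr /= e_sym e_pi // !inE !w_take //; lia.
have e_par i j : i < #|W| -> j < i -> e (w i) (w j) -> pi i = j.
  move=> iW ji eij; have ii : 0 < i < #|W| by lia.
  have lt := pi_lt i ii.
  apply: (@wI); [lia|lia|].
  apply: (unique_neighbour e_sym e_ac (C := [set x in take i s]) (r := w i)).
  - by apply: prefix_conn; lia.
  - rewrite inE; apply/negP => /take_w[k [ki kW wE]]; have ik := wI _ _ iW kW wE.
    by rewrite ik ltnn in ki.
  - by rewrite inE w_take //; lia.
  - by rewrite inE w_take //; lia.
  - exact: e_pi.
  - exact: eij.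
have iota_w a : a <= #|W| -> drop a s = [seq w i | i <- index_iota a #|W|].
  move=> aW; rewrite /index_iota -sizes /w map_nth_iota ?sizes //.
  by rewrite take_oversize // size_drop sizes.
exists w, pi, (fun i => t (w (pi i)) (w i)); split=> //.
- move=> x; have : x \in s by rewrite ms inE.
  by move=> /(nthP r)[i]; rewrite sizes => iW <-; exists i.
- split => // [i | a a0].
    have [iW|iW] := ltnP i #|W|; last first.
      rewrite (@eq_in_count _ _ pred0) ?count_pred0 // => j.
      rewrite mem_index_iota => jW; have := pi_lt j jW.
      by move=> lt /=; apply/negbTE/eqP; lia.
    apply: leq_trans (e_deg (w i)); rewrite -size_filter.
    have u : uniq (map w [seq j <- index_iota 1 #|W| | pi j == i]).
      rewrite map_inj_in_uniq ?filter_uniq ?iota_uniq // => j k.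
      rewrite !mem_filter !mem_index_iota => /and3P[_ _ jW] /and3P[_ _ kW].
      exact: wI.
    rewrite -(size_map w) -(card_uniqP u); apply: subset_leq_card.
    apply/subsetP => x /mapP[j]; rewrite mem_filter mem_index_iota => /andP[/eqP <- jW] ->.
    by rewrite inE e_sym; apply: e_pi.
  have [aW|aW] := leqP a #|W|; last first.
    by rewrite /index_iota (eqP (_ : #|W| - a == 0)) // subn_eq0 ltnW.
  have := bs a a0; rewrite cardsT; apply: leq_trans.
  rewrite iota_w // count_map -!size_filter; apply: uniq_leq_size.
    by rewrite filter_uniq ?iota_uniq.
  move=> j; rewrite !mem_filter => /andP[lt jW]; rewrite jW andbT /=.
  move: jW; rewrite mem_index_iota => jW.
  by apply/hasP; exists (w (pi j)); [apply: w_take | apply: e_pi; lia].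
move=> i j iW jW tij; have [ij|ji|ij] := ltngtP i j.
- left; have pj : pi j = i.
    by apply: e_par => //; rewrite /e /underlying /= tij orbT.
  by rewrite pj; split=> //; lia.
- right; have pj : pi i = j by apply: e_par => //; rewrite /e /underlying /= tij.
  rewrite pj; split=> //; first lia.
  by have := t_anti (w i) (w j); rewrite tij.
- by move: tij; rewrite -ij => tii; have := e_irr (w i); rewrite /e /underlying /= tii.
Qed.

(** * Doubly stochastic kernels on dense digraphs *)

Section RegularMatrix.
Variables (V : finType) (h : rel V) (U : {set V}) (d D B s : nat).
Hypothesis out_deg : forall x, x \in U -> d <= #|[set y in U | h x y]|.
Hypothesis in_deg : forall y, y \in U -> d <= #|[set x in U | h x y]|.
Hypothesis leUD : #|U| <= D.
Hypothesis B_gt0 : 0 < B.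
Hypothesis ltDs : D < s.+1 * B.
Hypothesis dense : #|U| * D + #|U| * #|U| <= 2 * (d - s) * D.

(** Integral weights let the total drive an induction. After division by [D], the bounds 1 and [B]
    on the edges become the lower and upper bounds of the kernel. *)
Definition weighting (M : V -> V -> nat) : Prop :=
  [/\ forall x y, 0 < M x y -> [&& x \in U, y \in U & h x y],
      forall x y, x \in U -> y \in U -> h x y -> 0 < M x y <= B,
      forall x, x \in U -> \sum_(y in U) M x y <= D &
      forall y, y \in U -> \sum_(x in U) M x y <= D].

Let tot (M : V -> V -> nat) := \sum_(x in U) \sum_(y in U) M x y.

Let delta (a b x y : V) : nat := (a == x) && (b == y).

Let delta_row a x y : y \in U -> \sum_(b in U) delta a b x y = (a == x).
Proof.
move=> yU; rewrite (bigD1 y) //= /delta eqxx andbT big1 ?addn0 // => b /andP[_ /negbTE->].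
by rewrite andbF.
Qed.

Let delta_col b x y : x \in U -> \sum_(a in U) delta a b x y = (b == y).
Proof.
move=> xU; rewrite (bigD1 x) //= /delta eqxx /= big1 ?addn0 // => a /andP[_ /negbTE->].
by [].
Qed.

Let saturated_le (F : V -> nat) x : x \in U -> \sum_(y in U) F y <= D ->
  #|[set y in U | F y >= B]| <= s.
Proof.
move=> xU le; rewrite -ltnS -(ltn_pmul2r B_gt0); apply: leq_ltn_trans ltDs.
apply: leq_trans le; rewrite -sum_nat_const [leqRHS](bigID (fun y => F y >= B)) /=.
rewrite -[leqLHS]addn0; apply: leq_add => //.
rewrite [leqRHS](eq_bigl [in [set y in U | F y >= B]]) => [|y]; last by rewrite !inE.
by apply: leq_sum => y; rewrite inE => /andP[].
Qed.

(* A deficient row [x] and a deficient column [y] are repaired by moving one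
   unit of some edge [a -> b] to the edges [x -> b] and [a -> y]. *)
Lemma weighting_improve M : weighting M -> tot M < #|U| * D ->
  exists2 M', weighting M' & tot M' = (tot M).+1.
Proof.
move=> wM ltM; have [suppM edgeM rowM colM] := wM.
have [x xU ltx] : exists2 x, x \in U & \sum_(y in U) M x y < D.
  apply/exists_inP; apply: contraLR ltM; rewrite negb_exists_in -leqNgt => /forall_inP H.
  by rewrite -sum_nat_const; apply: leq_sum => x /H; rewrite -leqNgt.
have [y yU lty] : exists2 y, y \in U & \sum_(x in U) M x y < D.
  apply/exists_inP; apply: contraLR ltM; rewrite negb_exists_in -leqNgt => /forall_inP H.
  by rewrite -sum_nat_const /tot exchange_big; apply: leq_sum => z /H; rewrite -leqNgt.
have simple a b : a \in U -> b \in U -> h a b -> M a b < B ->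
    \sum_(y in U) M a y < D -> \sum_(x in U) M x b < D ->
    exists2 M', weighting M' & tot M' = (tot M).+1.
  move=> aU bU hab ltB lta ltb; exists (fun u v => M u v + delta u v a b).
    split.
    - move=> u v; rewrite addn_gt0 => /orP[/suppM //|].
      by rewrite /delta lt0b => /andP[/eqP-> /eqP->]; rewrite aU bU.
    - move=> u v uU vU huv; have := edgeM u v uU vU huv; rewrite /delta.
      by have [->|] := eqVneq u a; have [->|] := eqVneq v b; rewrite /=; move: ltB; clear; lia.
    - move=> u uU; rewrite big_split /= delta_row //.
      by have [->|_] := eqVneq u a; rewrite /= ?addn1 // addn0 rowM.
    - move=> v vU; rewrite big_split /= delta_col //.
      by have [->|_] := eqVneq v b; rewrite /= ?addn1 // addn0 colM.
  rewrite /tot (eq_bigr (fun u => \sum_(v in U) M u v + (u == a))); last first.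
    by move=> u uU; rewrite big_split /= delta_row.
  rewrite big_split /= -[in RHS]addn1; congr (_ + _).
  by rewrite (bigD1 a) //= eqxx big1 // => u /andP[_ /negbTE->].
(* [x] can send one more unit to the columns in [Nx], and the rows in [Ny] can send one more to [y].
   A row or column has at most [s] saturated entries, whence the bounds [d - s]. *)
pose Nx := [set b in U | h x b && (M x b < B)].
pose Ny := [set a in U | h a y && (M a y < B)].
have cardNx : d - s <= #|Nx|.
  have := out_deg xU; have := saturated_le xU (rowM x xU).
  rewrite -(cardsID [set y in U | B <= M x y] [set y in U | h x y]) => h1 h2.
  have h3 : #|[set y in U | h x y] :\: [set y in U | B <= M x y]| = #|Nx|.
    by apply: eq_card => z; rewrite !inE ltnNge; case: (z \in U) => //=; rewrite andbC.
  have h4 := subset_leq_card (subsetIr [set y in U | h x y] [set y in U | B <= M x y]).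
  lia.
have cardNy : d - s <= #|Ny|.
  have := in_deg yU; have := saturated_le yU (colM y yU).
  rewrite -(cardsID [set x in U | B <= M x y] [set x in U | h x y]) => h1 h2.
  have h3 : #|[set x in U | h x y] :\: [set x in U | B <= M x y]| = #|Ny|.
    by apply: eq_card => z; rewrite !inE ltnNge; case: (z \in U) => //=; rewrite andbC.
  have h4 := subset_leq_card (subsetIr [set x in U | h x y] [set x in U | B <= M x y]).
  lia.
have [|] := boolP [exists b in Nx, \sum_(x in U) M x b < D].
  move=> /exists_inP[b]; rewrite inE => /and3P[bU hxb ltB] ltb.
  exact: (simple x b).
rewrite negb_exists_in => /forall_inP fullx.
have [|] := boolP [exists a in Ny, \sum_(y in U) M a y < D].
  move=> /exists_inP[a]; rewrite inE => /and3P[aU hay ltB] lta.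
  exact: (simple a y).
rewrite negb_exists_in => /forall_inP fully.
(* The rows in [Ny] and the columns in [Nx] are full by now. If all entries where they cross were at
   most 1, the total weight would be at least [2 * (d - s) * D - #|U| * #|U|], hence at least
   [#|U| * D] by [dense]. So some crossing entry can lose a unit and stay positive. *)
have [|] := boolP [exists a in Ny, [exists b in Nx, 1 < M a b]]; last first.
  rewrite negb_exists_in => /forall_inP small; exfalso.
  have smallM a b : a \in Ny -> b \in Nx -> M a b <= 1.
    move=> /small; rewrite negb_exists_in => /forall_inP H /H.
    by rewrite -leqNgt.
  have NyU : Ny \subset U by apply/subsetP => a; rewrite inE => /andP[].
  have NxU : Nx \subset U by apply/subsetP => a; rewrite inE => /andP[].
  have e1 : \sum_(a in Ny) \sum_(b in U) M a b >= #|Ny| * D.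
    by rewrite -sum_nat_const; apply: leq_sum => a /fully; rewrite -leqNgt.
  have e2 : \sum_(b in Nx) \sum_(a in U) M a b >= #|Nx| * D.
    by rewrite -sum_nat_const; apply: leq_sum => a /fullx; rewrite -leqNgt.
  have e3 : \sum_(b in Nx) \sum_(a in Ny) M a b <= #|U| * #|U|.
    apply: leq_trans (_ : \sum_(b in Nx) \sum_(a in Ny) 1 <= _).
      by apply: leq_sum => b bN; apply: leq_sum => a aN; apply: smallM.
    rewrite sum_nat_const sum1_card; apply: leq_mul; exact: subset_leq_card.
  have e4 : tot M = \sum_(a in Ny) \sum_(b in U) M a b +
      \sum_(a in U :\: Ny) \sum_(b in U) M a b.
    by rewrite /tot (big_setID Ny) /= (setIidPr NyU).
  have e5 : \sum_(b in Nx) \sum_(a in U) M a b = \sum_(b in Nx) \sum_(a in Ny) M a b +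
      \sum_(b in Nx) \sum_(a in U :\: Ny) M a b.
    rewrite -big_split /=; apply: eq_bigr => b _.
    by rewrite (big_setID Ny) /= (setIidPr NyU).
  have e6 : \sum_(b in Nx) \sum_(a in U :\: Ny) M a b <= \sum_(a in U :\: Ny) \sum_(b in U) M a b.
    rewrite exchange_big /=; apply: leq_sum => a _.
    rewrite [leqRHS](big_setID Nx) /= (setIidPr NxU); exact: leq_addr.
  have e7 : (d - s) * D <= #|Nx| * D by rewrite leq_mul2r cardNx orbT.
  have e8 : (d - s) * D <= #|Ny| * D by rewrite leq_mul2r cardNy orbT.
  move: dense; rewrite -mulnA mul2n -addnn; lia.
move=> /exists_inP[a aN /exists_inP[b bN ltMab]].
move: (aN) (bN); rewrite !inE => /and3P[aU hay ltay] /and3P[bU hxb ltxb].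
have ax : a != x by apply: contraNneq (fully _ aN) => ->.
have yb : b != y by apply: contraNneq (fullx _ bN) => ->.
have hab : h a b by have /and3P[] := suppM a b (ltnW ltMab).
pose M' u v := M u v + delta u v x b + delta u v a y - delta u v a b.
have M'E u v : M' u v + delta u v a b = M u v + delta u v x b + delta u v a y.
  rewrite subnK // /delta; case: (u =P a) => [->|] //=; case: (v =P b) => [->|] //=.
  by move: ltMab; clear; lia.
have rowM' u : u \in U -> \sum_(v in U) M' u v = \sum_(v in U) M u v + (u == x).
  move=> uU.
  have : \sum_(v in U) (M' u v + delta u v a b) =
      \sum_(v in U) (M u v + delta u v x b + delta u v a y).
    by apply: eq_bigr => v _; apply: M'E.
  by rewrite !big_split /= !delta_row // => /addIn.
have colM' v : v \in U -> \sum_(u in U) M' u v = \sum_(u in U) M u v + (v == y).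
  move=> vU.
  have : \sum_(u in U) (M' u v + delta u v a b) =
      \sum_(u in U) (M u v + delta u v x b + delta u v a y).
    by apply: eq_bigr => u _; apply: M'E.
  by rewrite !big_split /= !delta_col // addnAC => /addIn.
exists M'.
  split.
  - move=> u v M'0; have : 0 < M u v + delta u v x b + delta u v a y.
      by rewrite -M'E ltn_addr.
    rewrite !addn_gt0 => /orP[/orP[/suppM //|]|].
      by rewrite /delta lt0b => /andP[/eqP-> /eqP->]; rewrite xU bU.
    by rewrite /delta lt0b => /andP[/eqP-> /eqP->]; rewrite aU yU.
  - move=> u v uU vU huv; have := edgeM u v uU vU huv; have := M'E u v; rewrite /delta.
    have [E1|] := eqVneq u a; have [E2|] := eqVneq v b; rewrite ?E1 ?E2 /= ?(negbTE ax) ?(negbTE yb) /=.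
    + by rewrite ?eqxx /=; move: ltMab; clear; lia.
    + by rewrite ?eqxx /=; have [E3|] := eqVneq v y; rewrite ?E3 /= => _; move: ltay; clear; lia.
    + by rewrite ?eqxx /=; have [E3|] := eqVneq u x; rewrite ?E3 /= => _; move: ltxb; clear; lia.
    + by rewrite ?andbF /=; clear; lia.
  - move=> u uU; rewrite rowM' //.
    by have [->|_] := eqVneq u x; rewrite /= ?addn1 // addn0 rowM.
  - move=> v vU; rewrite colM' //.
    by have [->|_] := eqVneq v y; rewrite /= ?addn1 // addn0 colM.
rewrite /tot (eq_bigr _ rowM') big_split /= -[in RHS]addn1; congr (_ + _).
by rewrite (bigD1 x) //= eqxx big1 // => u /andP[_ /negbTE->].
Qed.

(** Starting from weight 1 on every edge, improvements raise the total to its maximum [#|U| * D],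
    where no row or column can be deficient. *)
Lemma regular_weighting : exists M, [/\ weighting M,
  forall x, x \in U -> \sum_(y in U) M x y = D &
  forall y, y \in U -> \sum_(x in U) M x y = D].
Proof.
have bound M : weighting M -> tot M <= #|U| * D.
  by move=> [_ _ rowM _]; rewrite -sum_nat_const; apply: leq_sum.
pose M0 x y : nat := [&& x \in U, y \in U & h x y].
have wM0 : weighting M0.
  split.
  - by move=> x y; rewrite lt0b.
  - by move=> x y; rewrite /M0 => -> -> ->.
  - move=> x xU; apply: leq_trans leUD; rewrite -sum1_card; apply: leq_sum => y _.
    exact: leq_b1.
  - move=> x xU; apply: leq_trans leUD; rewrite -sum1_card; apply: leq_sum => y _.
    exact: leq_b1.
suff [M wM totM] : exists2 M, weighting M & tot M = #|U| * D.
  exists M; have [suppM edgeM rowM colM] := wM; split=> // z zU; apply/eqP.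
    apply: contra_eqT totM; rewrite neq_ltn => /orP[lt|]; last by rewrite ltnNge rowM.
    rewrite neq_ltn /tot -sum_nat_const (bigD1 z) //= [in X in _ < X](bigD1 z) //=.
    by rewrite -addSn leq_add // leq_sum // => y /andP[/rowM].
  apply: contra_eqT totM; rewrite neq_ltn => /orP[lt|]; last by rewrite ltnNge colM.
  rewrite /tot exchange_big neq_ltn -sum_nat_const (bigD1 z) //= [in X in _ < X](bigD1 z) //=.
  by rewrite -addSn leq_add // leq_sum // => y /andP[/colM].
have [k] := ubnP (#|U| * D - tot M0); elim: k M0 wM0 => // k IHk M wM ltk.
have [lt|] := ltnP (tot M) (#|U| * D).
  have [M' wM' tM'] := weighting_improve wM lt.
  by apply: (IHk M' wM'); rewrite tM'; move: ltk lt; clear; lia.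
by move=> ge; exists M => //; apply/eqP; rewrite eqn_leq bound.
Qed.
End RegularMatrix.

Local Open Scope ring_scope.

Section Kernel.
Variables (R : realType) (V : finType) (g : rel V).

(** The Boolean is the direction of a tree edge seen from the parent, so that children along
    outgoing and incoming edges are treated alike. *)
Definition adj (s : bool) : rel V := fun x y => if s then g x y else g y x.

Definition nbhd (s : bool) (x : V) : {set V} := [set y | adj s x y].

Lemma adjC s x y : adj (~~ s) x y = adj s y x.
Proof. by case: s. Qed.

(** [Q false] is the transpose of [Q true], so the row sums for both values of [s] together say that
    the kernel is doubly stochastic. *)
Definition kernel_on (U : {set V}) (lo hi : R) (Q : bool -> V -> V -> R) : Prop :=
  [/\ forall s x y, Q (~~ s) x y = Q s y x,
      forall s x y, 0 <= Q s x y <= hi,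
      forall s x y, Q s x y != 0 -> [&& x \in U, y \in U & adj s x y],
      forall s x y, x \in U -> y \in U -> adj s x y -> lo <= Q s x y &
      forall s x, x \in U -> \sum_(y in U) Q s x y = 1].

(** Take [D = C * #|U|] and let [d] be the least degree. The bound on [B] makes [s = D %/ B] at most
    [a / 2 * #|U|], so that [2 * (d - s) * D] is at least [(1 + a) * #|U| * D]; the bound on [C]
    makes the surplus [a * #|U| * D] at least [#|U| * #|U|]. *)
Lemma kernel_exists (U : {set V}) (a : R) (C B : nat) :
  0 < a -> (0 < #|U|)%N ->
  (forall s x, x \in U -> (2^-1 + a) * #|U|%:R <= #|nbhd s x :&: U|%:R) ->
  1 <= a * C%:R -> 2 * C%:R <= a * B%:R ->
  exists Q, kernel_on U (C%:R * #|U|%:R)^-1 (B%:R / (C%:R * #|U|%:R)) Q.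
Proof.
move=> a0 U0 degU aC aB.
have C0 : (0 < C)%N by rewrite lt0n; apply/eqP => C0; move: aC; rewrite C0 mulr0 ler10.
have B0 : (0 < B)%N.
  rewrite lt0n; apply/eqP => B0; move: aB; rewrite B0 mulr0 leNgt.
  by rewrite mulr_gt0 // ltr0n.
have u0 : 0 < #|U|%:R :> R by rewrite ltr0n.
have CR0 : 0 < C%:R :> R by rewrite ltr0n.
have BR0 : 0 < B%:R :> R by rewrite ltr0n.
have [x0 x0U] := card_gt0P U0.
pose dg (p : bool * V) := #|nbhd p.1 p.2 :&: U|.
pose p0 := [arg min_(p < (true, x0) | p.2 \in U) dg p].
have [p0U p0min] : p0.2 \in U /\ forall p, p.2 \in U -> (dg p0 <= dg p)%N.
  by rewrite /p0; case: arg_minnP.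
pose D := (C * #|U|)%N; pose s := (D %/ B)%N.
have leUD : (#|U| <= D)%N by rewrite leq_pmull.
have ltDs : (D < s.+1 * B)%N by rewrite ltn_ceil.
have degout x : x \in U -> (dg p0 <= #|[set y in U | g x y]|)%N.
  move=> xU; apply: leq_trans (p0min (true, x) xU) _; apply: subset_leq_card.
  by apply/subsetP => y; rewrite !inE andbC.
have degin x : x \in U -> (dg p0 <= #|[set y in U | g y x]|)%N.
  move=> xU; apply: leq_trans (p0min (false, x) xU) _; apply: subset_leq_card.
  by apply/subsetP => y; rewrite !inE andbC.
have dense : (#|U| * D + #|U| * #|U| <= 2 * (dg p0 - s) * D)%N.
  rewrite -(ler_nat R) natrD !natrM.
  have h1 := degU p0.1 p0.2 p0U; rewrite -[_ :&: _]/(nbhd p0.1 p0.2 :&: U) -/(dg p0) in h1.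
  have h2 : s%:R * B%:R <= C%:R * #|U|%:R :> R by rewrite -!natrM ler_nat leq_trunc_div.
  have h3 : s%:R <= a / 2 * #|U|%:R :> R.
    rewrite -(ler_pM2r BR0) (le_trans h2) //.
    by have := ler_wpM2r (ltW u0) aB; lra.
  have h4 : (2^-1 + a / 2) * #|U|%:R <= (dg p0 - s)%:R :> R.
    rewrite natrB; first by nra.
    rewrite -(ler_nat R); apply: le_trans h3 _; apply: le_trans h1; nra.
  have h5 : 0 <= C%:R * #|U|%:R :> R by rewrite mulr_ge0 // ltW.
  have h6 : #|U|%:R * #|U|%:R <= a * #|U|%:R * (C%:R * #|U|%:R) :> R by nra.
  have h7 := ler_wpM2r h5 h4.
  nra.
have [M [[suppM edgeM _ _] rowM colM]] := regular_weighting degout degin leUD B0 ltDs dense.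
have D0 : 0 < D%:R :> R by rewrite ltr0n muln_gt0 C0.
pose Q t x y : R := (if t then M x y else M y x)%:R / D%:R.
have MB x y : (M x y <= B)%N.
  have [->//|/suppM/and3P[xU yU gxy]] := posnP (M x y).
  by have /andP[] := edgeM _ _ xU yU gxy.
exists Q; rewrite -natrM -/D; split.
- by move=> [] x y.
- move=> t x y; rewrite /Q divr_ge0 ?ler0n //= ler_wpM2r ?invr_ge0 ?ler0n // ler_nat.
  by case: t.
- move=> t x y; rewrite /Q mulf_eq0 negb_or pnatr_eq0 -lt0n => /andP[+ _].
  by rewrite /adj; case: t => /suppM/and3P[-> -> ->].
- move=> t x y xU yU; rewrite /Q -[X in X <= _]mul1r ler_pM2r ?invr_gt0 //.
  rewrite ler1n; case: t => txy.
    by have /andP[] := edgeM _ _ xU yU txy.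
  by have /andP[] := edgeM _ _ yU xU txy.
- move=> t x xU; rewrite /Q -mulr_suml -natr_sum.
  by case: t; rewrite ?rowM ?colM // divff // gt_eqF.
Qed.

(** * The random walk of a kernel *)

Variables (U : {set V}) (lo hi : R) (Q : bool -> V -> V -> R).
Hypothesis kQ : kernel_on U lo hi Q.
Hypothesis lo_ge0 : 0 <= lo.

Definition walk (s : bool) (f : V -> R) (x : V) : R := \sum_(y in U) Q s x y * f y.

(** The columns of [Q] sum to 1 as well, so the uniform measure on [U] is stationary. *)
Lemma sum_walk s f : \sum_(x in U) walk s f x = \sum_(x in U) f x.
Proof.
have [QC _ _ _ Q1] := kQ.
rewrite exchange_big /=; apply: eq_bigr => y yU.
by rewrite -mulr_suml (eq_bigr (fun x => Q (~~ s) y x)) ?Q1 ?mul1r.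
Qed.

Lemma walk_cst s m x : x \in U -> walk s (fun=> m) x = m.
Proof. by have [_ _ _ _ Q1] := kQ => xU; rewrite /walk -mulr_suml Q1 // mul1r. Qed.

Lemma ler_walk s f1 f2 x : (forall y, y \in U -> f1 y <= f2 y) -> walk s f1 x <= walk s f2 x.
Proof.
have [_ Q0 _ _ _] := kQ.
move=> le12; apply: ler_sum => y yU; apply: ler_wpM2l (le12 y yU).
by have /andP[] := Q0 s x y.
Qed.

Lemma walk_sum s (I : Type) (r : seq I) (P : pred I) (F : I -> V -> R) x :
  walk s (fun y => \sum_(i <- r | P i) F i y) x = \sum_(i <- r | P i) walk s (F i) x.
Proof.
by rewrite /walk exchange_big /=; apply: eq_bigr => y _; rewrite mulr_sumr.
Qed.

Lemma walkD s f1 f2 x : walk s (fun y => f1 y + f2 y) x = walk s f1 x + walk s f2 x.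
Proof. by rewrite /walk -big_split /=; apply: eq_bigr => y _; rewrite mulrDr. Qed.

Lemma walkB s f1 f2 x : walk s (fun y => f1 y - f2 y) x = walk s f1 x - walk s f2 x.
Proof. by rewrite /walk -sumrB; apply: eq_bigr => y _; rewrite mulrBr. Qed.

(* Two steps of the walk dominate a positive multiple of the uniform measure. *)
Lemma walk_mix (k : R) s1 s2 f mu h x :
  (forall s s' x y, x \in U -> y \in U ->
     k <= #|[set z in U | adj s x z && adj s' y z]|%:R) ->
  x \in U -> (forall y, y \in U -> f y <= mu + h) ->
  \sum_(y in U) f y = #|U|%:R * mu ->
  walk s1 (walk s2 f) x <= mu + (1 - k * lo ^+ 2 * #|U|%:R) * h.
Proof.
move=> codeg xU fle sumf; have [QC Q0 _ Qlo _] := kQ.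
(* The deficit [F] is non-negative with sum [#|U| * h]. Any two vertices are joined by at least [k]
   two-step walks, each of probability at least [lo ^+ 2], so two steps see at least [k * lo ^+ 2]
   times that sum. *)
pose F y := mu + h - f y.
have F0 y : y \in U -> 0 <= F y by move=> /fle; rewrite /F subr_ge0.
have sumF : \sum_(y in U) F y = #|U|%:R * h.
  by rewrite sumrB sumr_const sumf -mulr_natl; ring.
have avgF s y : y \in U -> walk s F y = mu + h - walk s f y.
  by move=> yU; rewrite walkB walk_cst.
have avg2F : walk s1 (walk s2 F) x = mu + h - walk s1 (walk s2 f) x.
  rewrite -(walk_cst s1 (mu + h) xU) -walkB; apply: eq_bigr => y yU.
  by rewrite avgF.
suff : k * lo ^+ 2 * (#|U|%:R * h) <= walk s1 (walk s2 F) x.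
  rewrite avg2F; have -> : (1 - k * lo ^+ 2 * #|U|%:R) * h = h - k * lo ^+ 2 * (#|U|%:R * h) by ring.
  lra.
rewrite -sumF mulr_sumr /walk.
under [leRHS]eq_bigr do rewrite mulr_sumr.
rewrite exchange_big /=; apply: ler_sum => y yU.
under eq_bigr do rewrite mulrA.
rewrite -mulr_suml; apply: ler_wpM2r; first exact: F0.
apply: le_trans (_ : #|[set z in U | adj s1 x z && adj (~~ s2) y z]|%:R * lo ^+ 2 <= _).
  by apply: ler_wpM2r (codeg _ _ _ _ xU yU); rewrite exprn_ge0.
set S := [set z in U | _].
have SU : S \subset U by apply/subsetP => z; rewrite inE => /andP[].
rewrite mulr_natl -sumr_const [leRHS](big_setID S) /= (setIidPr SU).
rewrite -[leLHS]addr0; apply: lerD.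
  apply: ler_sum => z; rewrite inE adjC => /and3P[zU xz zy].
  by rewrite expr2 ler_pM // Qlo.
apply: sumr_ge0 => z _; have /andP[q1 _] := Q0 s1 x z; have /andP[q2 _] := Q0 s2 z y.
exact: mulr_ge0.
Qed.
End Kernel.

(** * Embedding one epoch *)

Section PartialEmbedding.
Variables (V : finType) (g : rel V) (pi : nat -> nat) (sg : nat -> bool).

Definition embeds (m : nat) (phi : nat -> V) : Prop :=
  (forall i j, i < m -> j < m -> phi i = phi j -> i = j)%N /\
  (forall i, (0 < i < m)%N -> adj g (sg i) (phi (pi i)) (phi i)).

Definition img (m : nat) (phi : nat -> V) : {set V} := [set phi (i : nat) | i : 'I_m].

Definition update (phi : nat -> V) (m : nat) (z : V) (i : nat) : V :=
  if i == m then z else phi i.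

Lemma imgP m phi x : reflect (exists2 i, (i < m)%N & x = phi i) (x \in img m phi).
Proof.
apply: (iffP imsetP) => [[i _ ->]|[i im ->]]; first by exists i.
by exists (Ordinal im).
Qed.

Lemma mem_img m phi i : (i < m)%N -> phi i \in img m phi.
Proof. by move=> im; apply/imgP; exists i. Qed.

Lemma card_img m phi : (forall i j, i < m -> j < m -> phi i = phi j -> i = j)%N ->
  #|img m phi| = m.
Proof.
move=> inj; rewrite card_imset ?card_ord // => i j /inj ij.
by apply/val_inj/ij.
Qed.

Lemma img_ext m phi psi : (forall i, i < m -> phi i = psi i)%N -> img m phi = img m psi.
Proof.
by move=> H; apply/setP => x; apply/imgP/imgP => -[i im ->]; exists i; rewrite ?H.
Qed.

Lemma embeds_update m phi z : (0 < m -> forall i, 0 < i <= m -> pi i < i)%N ->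
  embeds m phi -> z \notin img m phi ->
  ((0 < m)%N -> adj g (sg m) (phi (pi m)) z) -> embeds m.+1 (update phi m z).
Proof.
move=> lt [inj adjH] zN adjz; split => [i j|i /andP[i0 im]].
  rewrite !ltnS /update => im jm; case: eqP => [->|/eqP ni]; case: eqP => [->|/eqP nj] //.
  - by move=> ze; case/imgP: zN; exists j; rewrite // ltn_neqAle nj.
  - by move=> ze; case/imgP: zN; exists i; rewrite // ltn_neqAle ni.
  by apply: inj; rewrite ltn_neqAle ?ni ?nj.
have m0 : (0 < m)%N by lia.
have := lt m0 i; rewrite i0 -ltnS im => /(_ isT) lti.
rewrite /update; case: (pi i =P m) => [|_]; first by lia.
case: eqP => [->|/eqP nim]; first exact: adjz.
by apply: adjH; rewrite i0 ltn_neqAle nim -ltnS.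
Qed.
End PartialEmbedding.

(** * Expected costs inside an epoch *)

Lemma count_index_iota_le (P : pred nat) a b a' b' : (a' <= a)%N -> (b <= b')%N ->
  (count P (index_iota a b) <= count P (index_iota a' b'))%N.
Proof.
move=> aa bb; rewrite -!size_filter; apply: uniq_leq_size.
  by rewrite filter_uniq ?iota_uniq.
by move=> i; rewrite !mem_filter !mem_index_iota => /andP[-> /andP[ai ib]] /=; lia.
Qed.

(** Excess cost of a subtree, in units of [h], after [J] rounds of two generations. A round charges
    1 for the vertex and 1 for each of its children, and hands the at most [Delta ^ 2] grandchildren
    on, contracted by [gamma]. The bound does not depend on the length of the epoch. *)
Fixpoint walk_cost (R : realType) (gamma : R) (Delta J : nat) : R :=
  if J is J'.+1 then
    1 + Delta%:R + gamma * Delta%:R ^+ 2 * walk_cost gamma Delta J'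
  else 0.

Section Epoch.
Variables (R : realType) (V : finType) (g : rel V).
Variables (Delta L n : nat) (pi : nat -> nat) (sg : nat -> bool).
Hypothesis pa : parent_array Delta L n pi.
Variables (U : {set V}) (lo hi k : R) (Q : bool -> V -> V -> R).
Hypothesis kQ : kernel_on g U lo hi Q.
Hypothesis lo_ge0 : 0 <= lo.
Hypothesis hi_ge0 : 0 <= hi.
Hypothesis codeg : forall s s' x y, x \in U -> y \in U ->
  k <= #|[set z in U | adj g s x z && adj g s' y z]|%:R.
Variable gamma : R.
Hypothesis gammaE : gamma = 1 - k * lo ^+ 2 * #|U|%:R.
Hypothesis gamma01 : 0 <= gamma <= 1.
Variables (a0 b0 : nat) (f : V -> R) (mu h : R).
Hypothesis a0_gt0 : (0 < a0)%N.
Hypothesis b0_le : (b0 <= n)%N.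
Hypothesis f_bound : forall x, x \in U -> 0 <= f x <= h.
Hypothesis f_mean : \sum_(x in U) f x = #|U|%:R * mu.
Hypothesis mu_bound : 0 <= mu <= h.

Local Notation avg := (walk U Q).

(* Expected total cost of the descendants of [i] in the epoch, as a function of
   the image of [i], when they follow the random walk [Q]. *)
Fixpoint cost_rec (m i : nat) : V -> R :=
  if m is m'.+1 then
    fun z => f z + \sum_(i.+1 <= j < b0 | pi j == i) avg (sg j) (cost_rec m' j) z
  else f.

(** Size of the subtree of [i] within the epoch. The argument [m] is fuel, here as in [cost_rec]:
    children have larger indices, so [b0] units always suffice. *)
Fixpoint size_rec (m i : nat) : R :=
  if m is m'.+1 then 1 + \sum_(i.+1 <= j < b0 | pi j == i) size_rec m' j else 1.

Definition cost := cost_rec b0.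
Definition size_in := size_rec b0.

Let avg_ext s f1 f2 x : f1 =1 f2 -> avg s f1 x = avg s f2 x.
Proof. by move=> H; apply: eq_bigr => y _; rewrite H. Qed.

Lemma cost_rec_stable m i z : (b0 <= i + m)%N -> cost_rec m i z = cost_rec m.+1 i z.
Proof.
elim: m i z => [|m IH] i z le; first by rewrite /= big_geq ?addr0 //; lia.
rewrite [RHS]/= [LHS]/=; congr (_ + _); apply: congr_big_nat => // j /andP[_ /andP[ij _]].
by apply: avg_ext => y; apply: IH; lia.
Qed.

Lemma size_rec_stable m i : (b0 <= i + m)%N -> size_rec m i = size_rec m.+1 i.
Proof.
elim: m i => [|m IH] i le; first by rewrite /= big_geq ?addr0 //; lia.
rewrite [RHS]/= [LHS]/=; congr (_ + _); apply: congr_big_nat => // j /andP[_ /andP[ij _]].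
by apply: IH; lia.
Qed.

Lemma costE i z :
  cost i z = f z + \sum_(i.+1 <= j < b0 | pi j == i) avg (sg j) (cost j) z.
Proof. by rewrite {1}/cost cost_rec_stable //; lia. Qed.

Lemma size_inE i :
  size_in i = 1 + \sum_(i.+1 <= j < b0 | pi j == i) size_in j.
Proof. by rewrite {1}/size_in size_rec_stable //; lia. Qed.

Lemma size_in_ge0 i : 0 <= size_in i.
Proof.
rewrite /size_in; elim: b0 i => [|m IH] i //=.
by rewrite addr_ge0 // sumr_ge0.
Qed.

Lemma cost_ge0 i z : z \in U -> 0 <= cost i z.
Proof.
have [_ Q0 _ _ _] := kQ.
rewrite /cost; elim: b0 i z => [|m IH] i z zU /=; first by have /andP[] := f_bound zU.
rewrite addr_ge0 //; first by have /andP[] := f_bound zU.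
apply: sumr_ge0 => j _; apply: sumr_ge0 => y yU; rewrite mulr_ge0 ?IH //.
by have /andP[] := Q0 (sg j) z y.
Qed.

(** By stationarity, from a uniform start every descendant costs [mu] on average. *)
Lemma sum_cost i : \sum_(x in U) cost i x = #|U|%:R * (size_in i * mu).
Proof.
rewrite /cost /size_in; elim: b0 i => [|m IH] i /=; first by rewrite f_mean mul1r.
rewrite big_split /= f_mean exchange_big /= mulrDl mul1r mulrDr; congr (_ + _).
rewrite mulr_suml mulr_sumr; apply: eq_bigr => j _.
by rewrite (sum_walk kQ) IH.
Qed.

Lemma cost_le i z : z \in U -> cost i z <= size_in i * (mu + h).
Proof.
rewrite /cost /size_in; elim: b0 i z => [|m IH] i z zU /=.
  by rewrite mul1r; have /andP[f0 f1] := f_bound zU; move: mu_bound; lra.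
rewrite mulrDl mul1r lerD //.
  by have /andP[f0 f1] := f_bound zU; move: mu_bound; lra.
rewrite mulr_suml; apply: ler_sum => j _.
rewrite -[leRHS](walk_cst kQ (sg j) _ zU); apply: (ler_walk kQ) => y yU.
exact: IH.
Qed.

Local Notation root_cost := (walk_cost gamma Delta).

Lemma root_cost_ge0 J : 0 <= root_cost J.
Proof.
elim: J => //= J IH; have /andP[g0 _] := gamma01.
by rewrite !addr_ge0 ?mulr_ge0 ?exprn_ge0.
Qed.

Lemma children_le i : \sum_(i.+1 <= j < b0 | pi j == i) (1 : R) <= Delta%:R.
Proof.
have [_ ch _] := pa.
rewrite (eq_bigr (fun=> 1%:R)) // -natr_sum ler_nat sum1_count.
apply: leq_trans (ch i); apply: count_index_iota_le; lia.
Qed.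

(** Expand two generations. The vertex and its children cost at most [mu + h] each; the cost of a
    grandchild is averaged over two steps of the walk, so by [walk_mix] its excess over the mean
    shrinks by the factor [gamma]. After [J] rounds the start [z] matters only through a term
    independent of the subtree size and the small multiple [gamma ^+ J] of that size. *)
Lemma cost_decay J i z : z \in U ->
  cost i z <= size_in i * mu + h * (root_cost J + gamma ^+ J * size_in i).
Proof.
have /andP[g0 g1] := gamma01; have /andP[mu0 muh] := mu_bound.
have h0 : 0 <= h by lra.
elim: J i z => [|J IH] i z zU.
  by rewrite /= add0r expr0 mul1r [h * _]mulrC -mulrDr cost_le.
have f_le y : y \in U -> f y <= mu + h by move=> /f_bound; lra.
have avgf s : avg s f z <= mu + h.
  by rewrite -[leRHS](walk_cst kQ s _ zU); apply: (ler_walk kQ).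
have step j : avg (sg j) (cost j) z <= mu + h +
    \sum_(j.+1 <= l < b0 | pi l == j)
      (size_in l * mu + gamma * (h * (root_cost J + gamma ^+ J * size_in l))).
  rewrite (avg_ext (sg j) z (costE j)) walkD lerD //.
  rewrite walk_sum; apply: ler_sum => l _.
  have := @walk_mix _ _ _ _ _ _ _ kQ lo_ge0 k (sg j) (sg l) (cost l) (size_in l * mu)
    (h * (root_cost J + gamma ^+ J * size_in l)) z codeg zU (fun y => IH l y) (sum_cost l).
  by rewrite -gammaE.
rewrite costE.
pose A := root_cost J; pose q := gamma ^+ J.
have A0 : 0 <= A by apply: root_cost_ge0.
have q0 : 0 <= q by rewrite exprn_ge0.
have step' j : avg (sg j) (cost j) z <=
    size_in j * (mu + gamma * q * h) + (h + gamma * h * A * Delta%:R) * 1.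
  apply: le_trans (step j) _; rewrite big_split /= -mulr_suml.
  rewrite -mulr_sumr -mulr_sumr big_split /= -mulr_sumr.
  have := size_inE j; set S := \sum_(_ <= l < _ | _) size_in l => ->.
  have -> : \sum_(j.+1 <= l < b0 | pi l == j) root_cost J =
      A * \sum_(j.+1 <= l < b0 | pi l == j) 1.
    by rewrite mulr_sumr; apply: eq_bigr => l _; rewrite mulr1.
  have c1 := children_le j; set c := \sum_(_ <= l < _ | _) 1 in c1 *.
  have S0 : 0 <= S by apply: sumr_ge0 => l _; apply: size_in_ge0.
  rewrite -/q.
  have h1 : gamma * (h * A) * c <= gamma * (h * A) * Delta%:R.
    by apply: ler_wpM2l c1; rewrite !mulr_ge0.
  have h2 : 0 <= gamma * q * h by rewrite !mulr_ge0.
  nra.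
apply: le_trans (lerD (f_le z zU) (ler_sum _ (fun j _ => step' j))) _.
rewrite big_split /= -mulr_suml -mulr_sumr.
have := size_inE i; set S := \sum_(_ <= l < _ | _) size_in l => ->.
have c1 := children_le i; set c := \sum_(_ <= l < _ | _) 1 in c1 *.
have S0 : 0 <= S by apply: sumr_ge0 => l _; apply: size_in_ge0.
have h1 : (h + gamma * h * A * Delta%:R) * c <= (h + gamma * h * A * Delta%:R) * Delta%:R.
  by apply: ler_wpM2l c1; rewrite addr_ge0 ?mulr_ge0.
have h2 : 0 <= gamma * q * h by rewrite !mulr_ge0.
rewrite /= -/A (exprS gamma) -/q -subr_ge0.
set X := (X in X * c) in h1 *.
have -> : (1 + S) * mu + h * (1 + Delta%:R + gamma * Delta%:R ^+ 2 * A + gamma * q * (1 + S)) -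
  (mu + h + (S * (mu + gamma * q * h) + X * c)) =
  gamma * q * h + (X * Delta%:R - X * c) by rewrite /X; ring.
by rewrite addr_ge0 // subr_ge0.
Qed.
(** The frontier consists of the unplaced vertices whose parent is placed. Placing [i] removes [i]
    from it and puts the children of [i] in. *)
Lemma frontier_step (x : nat -> R) i : (0 < i < b0)%N ->
  \sum_(i.+1 <= j < b0 | (pi j < i.+1)%N) x j =
  \sum_(i <= j < b0 | (pi j < i)%N) x j - x i + \sum_(i.+1 <= j < b0 | pi j == i) x j.
Proof.
move=> /andP[i0 ib]; have [lt _ _] := pa.
rewrite [X in _ = X - _ + _]big_ltn_cond // lt; last by rewrite i0; lia.
rewrite [x i + _]addrC addrK (bigID (fun j => pi j < i)%N) /=; congr (_ + _).
  by apply: eq_bigl => j; rewrite ltnS andb_idl // => /ltnW.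
by apply: eq_bigl => j; rewrite ltnS -leqNgt eqn_leq.
Qed.

(** The subtrees of the frontier partition the part of the epoch that is still unplaced. *)
Lemma frontier_size i : (a0 <= i <= b0)%N ->
  \sum_(i <= j < b0 | (pi j < i)%N) size_in j = (b0 - i)%:R.
Proof.
move=> /andP[ai ib].
have [m mE] : exists m, b0 = (i + m)%N by exists (b0 - i)%N; rewrite subnKC.
elim: m i ai ib mE => [|m IH] i ai ib mE; first by rewrite big_geq ?mE ?addn0 ?subnn.
have := @frontier_step size_in i; rewrite IH; try lia.
have := size_inE i; set S := \sum_(_ <= l < _ | pi l == i) _ => sE.
rewrite mE => /(_ _) h1.
have -> : (i + m.+1 - i)%N = (i + m.+1 - i.+1)%N.+1 by lia.
rewrite -natr1 h1; last lia.
by rewrite sE; ring.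
Qed.

Lemma size_in_le i : (a0 <= i < b0)%N -> size_in i <= (b0 - a0)%:R.
Proof.
move=> /andP[ai ib]; have [lt _ _] := pa.
apply: (@le_trans _ _ ((b0 - i)%:R)); last by rewrite ler_nat; lia.
rewrite -frontier_size; last by rewrite ai ltnW.
rewrite big_ltn_cond // lt; last by lia.
by rewrite lerDl sumr_ge0 // => j _; apply: size_in_ge0.
Qed.

(** The forbidden set has probability at most [tau = hi * #|F|]. If every allowed step cost more
    than the average plus [delta], then [delta * (1 - tau)] would be at most [tau] times the
    average, which contradicts [tau <= 1 / 2] and [2 * tau * Gmax < delta]. *)
Lemma kernel_choice (F : {set V}) s x (G : V -> R) (Gmax delta : R) :
  x \in U -> (forall y, y \in U -> 0 <= G y <= Gmax) ->
  hi * #|F|%:R <= 2^-1 -> 2 * (hi * #|F|%:R) * Gmax < delta ->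
  exists z, [/\ z \in U, z \notin F, adj g s x z & G z <= avg s G x + delta].
Proof.
move=> xU GB tau1 tau2; have [_ Q0 Qs _ Q1] := kQ.
pose tau := hi * #|F|%:R.
have avgle : avg s G x <= Gmax.
  by rewrite -(walk_cst kQ s Gmax xU); apply: (ler_walk kQ) => y /GB/andP[].
have avgge : 0 <= avg s G x.
  by rewrite -(walk_cst kQ s 0 xU); apply: (ler_walk kQ) => y /GB/andP[].
have QF : \sum_(y in U :&: F) Q s x y <= tau.
  apply: (@le_trans _ _ (\sum_(y in U :&: F) hi)).
    by apply: ler_sum => y _; have /andP[] := Q0 s x y.
  rewrite sumr_const -[leLHS]mulr_natr ler_wpM2l // ler_nat subset_leq_card //.
  exact: subsetIr.
have QNF : 1 - tau <= \sum_(y in U :\: F) Q s x y.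
  by have := Q1 s x xU; rewrite (big_setID F) /=; lra.
have [/exists_inP[z]|] := boolP [exists z in U :\: F, (Q s x z != 0) && (G z <= avg s G x + delta)].
  rewrite !inE => /andP[zF zU] /andP[/Qs/and3P[_ _ xz] Gz].
  by exists z.
rewrite negb_exists_in => /forall_inP H; exfalso.
have : (avg s G x + delta) * (1 - tau) <= avg s G x.
  apply: (@le_trans _ _ (\sum_(y in U :\: F) Q s x y * G y)); last first.
    rewrite /walk [leRHS](big_setID F) /= lerDr sumr_ge0 // => y /setIP[yU _].
    by have /andP[q0 _] := Q0 s x y; have /andP[g0 _] := GB y yU; rewrite mulr_ge0.
  apply: (@le_trans _ _ (\sum_(y in U :\: F) (avg s G x + delta) * Q s x y)).
    rewrite -mulr_sumr; apply: ler_wpM2l => //.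
    have : 0 <= tau by rewrite mulr_ge0.
    have : 0 <= Gmax by apply: le_trans avgle.
    rewrite -/tau in tau2; nra.
  apply: ler_sum => y /H; have /andP[q0 _] := Q0 s x y.
  rewrite negb_and negbK -ltNge => /orP[/eqP->|lt]; first by rewrite mulr0 mul0r.
  by rewrite mulrC ler_wpM2l // ltW.
have t0 : 0 <= tau by rewrite mulr_ge0.
rewrite -/tau in tau1 tau2.
have d0 : 0 < delta by apply: le_lt_trans tau2; rewrite !mulr_ge0 // (le_trans avgge).
nra.
Qed.

Variables (delta : R) (J : nat) (phi : nat -> V).
Variable K : nat.
Hypothesis b0E : b0 = (a0 + K)%N.
Hypothesis phiE : embeds g pi sg a0 phi.
Hypothesis UE : U = ~: img a0 phi.
Hypothesis root_deg : forall s x, (K < #|nbhd g s x :&: U|)%N.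
Hypothesis hiK : hi * K%:R <= 2^-1.
Hypothesis deltaK : 2 * (hi * K%:R) * (K%:R * (mu + h)) < delta.

Lemma epoch : exists psi, [/\ embeds g pi sg b0 psi,
  forall i, (i < a0)%N -> psi i = phi i &
  \sum_(a0 <= i < b0) f (psi i) <= K%:R * mu + h * (root_cost J * L%:R + gamma ^+ J * K%:R) + K%:R * delta].
Proof.
have [pi_lt _ crossL] := pa.
have /andP[g0 g1] := gamma01; have /andP[mu0 muh] := mu_bound.
have h0 : 0 <= h by lra.
(* A frontier vertex is charged the average over its next step. If its parent precedes the epoch,
   that parent may lie outside [U], where the kernel vanishes; the charge is then [top], which by
   [cost_decay] is valid at every position, so that any free neighbour will do. *)
pose top j := size_in j * mu + h * (root_cost J + gamma ^+ J * size_in j).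
pose y psi j := if (pi j < a0)%N then top j else avg (sg j) (cost j) (psi (pi j)).
pose est psi i := \sum_(a0 <= j < i) f (psi j) + \sum_(i <= j < b0 | (pi j < i)%N) y psi j.
have bK : (b0 - a0 = K)%N by rewrite b0E addKn.
have a0b0 : (a0 <= b0 <= b0)%N by rewrite b0E leq_addr leqnn.
have a0b : (a0 <= a0 <= b0)%N by rewrite leqnn b0E leq_addr.
suff H m : (m <= K)%N -> exists psi, [/\ embeds g pi sg (a0 + m) psi,
    forall i, (i < a0)%N -> psi i = phi i & est psi (a0 + m)%N <= est phi a0 + m%:R * delta].
  have [psi [psiE psi_phi le]] := H K (leqnn K).
  rewrite -b0E in psiE le; exists psi; split => //.
  move: le; rewrite /est [X in _ + X <= _]big_geq // addr0 [X in _ <= X + _ + _]big_geq // add0r.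
  move=> le; apply: le_trans le _; rewrite lerD2r.
  rewrite (eq_bigr top) => [|j lt]; last by rewrite /y lt.
  rewrite big_split /= -mulr_suml frontier_size ?bK; last exact: a0b.
  rewrite lerD2l -mulr_sumr ler_wpM2l // big_split /= -mulr_sumr frontier_size ?bK; last exact: a0b.
  have -> : \sum_(a0 <= j < b0 | (pi j < a0)%N) root_cost J =
      root_cost J * \sum_(a0 <= j < b0 | (pi j < a0)%N) 1%:R.
    by rewrite mulr_sumr; apply: eq_bigr => j _; rewrite mulr1.
  rewrite lerD2r ler_wpM2l ?root_cost_ge0 // -natr_sum.
  rewrite ler_nat sum1_count; apply: leq_trans (crossL a0 a0_gt0).
  by apply: count_index_iota_le.
elim: m => [|m IH] mK.
  by exists phi; rewrite addn0 mul0r addr0; split.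
have [psi [psiE psi_phi lepsi]] := IH (ltnW mK).
rewrite addnS; move: psiE lepsi; have [i iE] : exists i, i = (a0 + m)%N by exists (a0 + m)%N.
rewrite -iE => psiE lepsi.
have ib : (i < b0)%N by rewrite iE b0E ltn_add2l.
have ai : (a0 <= i)%N by rewrite iE leq_addr.
have i0 : (0 < i)%N := leq_trans a0_gt0 ai.
have inn : (0 < i < n)%N by rewrite i0 (leq_trans ib b0_le).
have lti := pi_lt i inn.
have injpsi := psiE.1.
have memU j : (a0 <= j < i)%N -> psi j \in U.
  move=> /andP[aj ji]; rewrite UE inE; apply/negP => /imgP[l la].
  rewrite -psi_phi // => /injpsi E; have := E ji (leq_trans la ai) => jl.
  by move: la; rewrite -jl ltnNge aj.
pose F := img i psi :&: U.
have img_a0 : img a0 psi = img a0 phi by apply: img_ext.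
have cardF : (#|F| <= m)%N.
  have sub : img a0 psi \subset img i psi.
    by apply/subsetP => x /imgP[l la ->]; apply: mem_img (leq_trans la ai).
  have -> : F = img i psi :\: img a0 psi by rewrite /F img_a0 UE setDE.
  rewrite cardsD (setIidPr sub) card_img // card_img ?iE ?addKn // => u v ua va.
  by apply: injpsi; [apply: leq_trans ua ai | apply: leq_trans va ai].
have [z [zU zF adjz costz]] : exists z, [/\ z \in U, z \notin F,
    adj g (sg i) (psi (pi i)) z & cost i z <= y psi i + delta].
  have K0 : 0 <= K%:R :> R by [].
  have mhK : 0 <= mu + h by lra.
  have d0 : 0 < delta by apply: le_lt_trans deltaK; rewrite !mulr_ge0.
  rewrite /y; case: ifPn => [lt|ge].
    have [z] : exists z, z \in (nbhd g (sg i) (psi (pi i)) :&: U) :\: F.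
      apply/card_gt0P; rewrite cardsD subn_gt0.
      apply: leq_ltn_trans (root_deg _ _).
      by apply: leq_trans (subset_leq_card (subsetIr _ _))
        (leq_trans cardF (ltnW mK)).
    rewrite !inE => /and3P[zF adjz zU]; exists z; split=> //.
      by rewrite !inE.
    by apply: le_trans (cost_decay J i zU) _; rewrite lerDl ltW.
  have xU : psi (pi i) \in U by apply: memU; rewrite leqNgt ge.
  apply: (@kernel_choice F (sg i) (psi (pi i)) (cost i) (K%:R * (mu + h)) delta xU).
  - move=> z zU; rewrite cost_ge0 //=; apply: le_trans (cost_le i zU) _.
    by apply: ler_wpM2r => //; rewrite -bK; apply: size_in_le; rewrite ai.
  - apply: le_trans hiK; apply: ler_wpM2l => //; by rewrite ler_nat (leq_trans cardF (ltnW mK)).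
  - apply: le_lt_trans deltaK; apply: ler_wpM2r; first by rewrite mulr_ge0.
    by rewrite ler_pM2l // ler_wpM2l // ler_nat (leq_trans cardF (ltnW mK)).
have zN : z \notin img i psi by move: zF; rewrite inE zU andbT.
exists (update psi i z); split.
- apply: embeds_update => //.
  move=> _ j /andP[j0 ji]; apply: pi_lt; rewrite j0 (leq_ltn_trans ji) //.
  exact: leq_trans ib b0_le.
- by move=> j ja; rewrite /update ifN ?psi_phi // neq_ltn (leq_trans ja ai).
have upd j : (j < i)%N -> update psi i z j = psi j.
  by move=> ji; rewrite /update ifN // neq_ltn ji.
have -> : est (update psi i z) i.+1 = est psi i - y psi i + cost i z.
  rewrite /est big_nat_recr /=; last exact: ai.
  have -> : update psi i z i = z by rewrite /update eqxx.
  rewrite (eq_big_nat _ _ (F2 := fun j => f (psi j))); last by by move=> j /andP[_ jj]; rewrite upd.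
  rewrite frontier_step; last by rewrite i0.
  rewrite costE.
  have -> : \sum_(i <= j < b0 | (pi j < i)%N) y (update psi i z) j =
      \sum_(i <= j < b0 | (pi j < i)%N) y psi j.
    by apply: eq_bigr => j lt; rewrite /y upd.
  have -> : \sum_(i.+1 <= j < b0 | pi j == i) y (update psi i z) j =
      \sum_(i.+1 <= j < b0 | pi j == i) avg (sg j) (cost j) z.
    apply: eq_bigr => j /eqP ji.
    by rewrite /y ji /update eqxx ifN // -leqNgt.
  have -> : y (update psi i z) i = y psi i by rewrite /y upd.
  by ring.
rewrite -natr1; lra.
Qed.
End Epoch.

(** * Almost spanning embeddings *)

Lemma expR_le_quadratic (R : realType) (y : R) : y <= 2^-1 -> expR y <= 1 + y + 2 * y ^+ 2.
Proof.
move=> y1; have h1 := expR_ge1Dx (- y).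
have E : expR y * expR (- y) = 1 by rewrite -expRD subrr expR0.
have e0 := expR_gt0 y.
have e1 : expR y * (1 - y) <= 1 by rewrite -[leRHS]E ler_wpM2l // ltW.
have p : 0 < 1 - y by lra.
rewrite -(ler_pM2r p); apply: le_trans e1 _.
have -> : (1 + y + 2 * y ^+ 2) * (1 - y) = 1 + y ^+ 2 * (1 - 2 * y) by ring.
by rewrite lerDl mulr_ge0 ?sqr_ge0 //; lra.
Qed.

Section Almost.
Variables (R : realType) (V : finType) (g : rel V).
Variables (Delta L : nat) (pi : nat -> nat) (sg : nat -> bool).
Hypothesis pa : parent_array Delta L #|V| pi.
Variables (a eta lambda : R) (C B K J E : nat).
Hypothesis a_gt0 : 0 < a.
Hypothesis aC : 1 <= a * C%:R.
Hypothesis aB : 2 * C%:R <= a * B%:R.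
(** The contraction factor of [walk_mix] for codegree [2 * a * #|U|] and [lo = (C * #|U|)^-1]; it
    does not depend on [U]. *)
Let gamma : R := 1 - 2 * a / C%:R ^+ 2.
Hypothesis eta_gt0 : 0 < eta.
Hypothesis eta_le1 : eta <= 1.
Hypothesis lambda_gt0 : 0 < lambda.
Hypothesis K_gt0 : (0 < K)%N.
Hypothesis E_gt0 : (0 < E)%N.
Hypothesis KE : 12 * B%:R * K%:R ^+ 2 < eta * C%:R * E%:R.
Hypothesis lambdaE : lambda * K%:R <= 2^-1 * E%:R.
Hypothesis gammaJ : 3 * gamma ^+ J <= eta.

Hypothesis rootK : 3 * walk_cost gamma Delta J * L%:R <= eta * K%:R.

Definition free (m : nat) (phi : nat -> V) : {set V} := ~: img m phi.

Definition density (m : nat) (phi : nat -> V) (s : bool) (x : V) : R :=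
  #|nbhd g s x :&: free m phi|%:R / #|free m phi|%:R.

(** Used vertices are summed over too, since they may still have unplaced children. *)
Definition potential (m : nat) (phi : nat -> V) : R :=
  \sum_s \sum_x expR (- lambda * density m phi s x).

Let C_gt0 : 0 < C%:R :> R.
Proof. by rewrite -(pmulr_rgt0 _ a_gt0); apply: lt_le_trans aC. Qed.

Let B_gt0 : 0 < B%:R :> R.
Proof.
by rewrite -(pmulr_rgt0 _ a_gt0); apply: lt_le_trans aB; rewrite mulr_gt0.
Qed.

Lemma card_free m phi : embeds g pi sg m phi -> #|free m phi| = (#|V| - m)%N.
Proof. by move=> [inj _]; rewrite /free cardsCs setCK card_img. Qed.

Lemma card_nbhd_free m phi (N : {set V}) : embeds g pi sg m phi ->
  #|N :&: free m phi|%:R = #|N|%:R - \sum_(0 <= i < m) (phi i \in N)%:R :> R.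
Proof.
move=> [inj _]; apply/eqP; rewrite eq_sym subr_eq; apply/eqP.
rewrite -natr_sum -natrD; congr (_%:R); rewrite -(cardsID (img m phi) N) addnC -setDE.
congr (_ + _)%N; rewrite -sum1_card.
rewrite (eq_bigl (fun x => (x \in img m phi) && (x \in N))) => [|x]; last first.
  by rewrite !inE andbC.
rewrite big_mkcondr /= big_imset /= => [|i j _ _ /inj ij]; last exact/val_inj/ij.
by rewrite big_mkord; apply: eq_bigr => i _; case: (_ \in _).
Qed.

Lemma codegree (U : {set V}) (s s' : bool) (x y : V) :
  (forall s x, x \in U -> (2^-1 + a) * #|U|%:R <= #|nbhd g s x :&: U|%:R) ->
  x \in U -> y \in U ->
  2 * a * #|U|%:R <= #|[set z in U | adj g s x z && adj g s' y z]|%:R.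
Proof.
move=> degU xU yU; have h1 := degU s x xU; have h2 := degU s' y yU.
have := cardsUI (nbhd g s x :&: U) (nbhd g s' y :&: U).
have -> : #|nbhd g s x :&: U :&: (nbhd g s' y :&: U)| = #|[set z in U | adj g s x z && adj g s' y z]|.
  by apply: eq_card => z; rewrite !inE; case: (z \in U); rewrite ?andbF ?andbT.
move=> /(congr1 (fun k => k%:R : R)); rewrite !natrD => e.
have : #|nbhd g s x :&: U :|: nbhd g s' y :&: U|%:R <= #|U|%:R :> R.
  by rewrite ler_nat subset_leq_card // subUset !subsetIr.
lra.
Qed.

(** With the gradient as cost, an epoch consumes weighted neighbours at almost the average rate,
    which is the rate at which [U] itself shrinks. The first-order growth of the potential is
    therefore governed by [eta], and [expR_le_quadratic] bounds the rest by a second-order term. *)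
Lemma epoch_potential (a0 : nat) (phi : nat -> V) :
  (0 < a0)%N -> (a0 + K + E <= #|V|)%N -> embeds g pi sg a0 phi ->
  (forall s x, 2^-1 + a <= density a0 phi s x) ->
  exists psi, [/\ embeds g pi sg (a0 + K) psi,
    forall i, (i < a0)%N -> psi i = phi i &
    potential (a0 + K) psi <= potential a0 phi *
      expR (lambda * eta * K%:R / E%:R + 2 * (lambda * K%:R / E%:R) ^+ 2)].
Proof.
move=> a0_gt0 aE phiE dens.
pose U := free a0 phi.
have cU : #|U| = (#|V| - a0)%N := card_free phiE.
pose u : R := #|U|%:R.
have EKu : E%:R + K%:R <= u.
  by rewrite -natrD /u cU ler_nat; move: aE; clear; lia.
have E0 : 0 < E%:R :> R by rewrite ltr0n.
have K1 : 1 <= K%:R :> R by rewrite ler1n.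
have u0 : 0 < u by lra.
have U0 : (0 < #|U|)%N by rewrite -(ltr_nat R).
have degU s x : (2^-1 + a) * #|U|%:R <= #|nbhd g s x :&: U|%:R.
  by have := dens s x; rewrite /density ler_pdivlMr.
have [Q kQ] := kernel_exists a_gt0 U0 (fun s x _ => degU s x) aC aB.
have CU0 : 0 < C%:R * #|U|%:R :> R by rewrite mulr_gt0.
set lo := (C%:R * _)^-1 in kQ; set hi := B%:R / _ in kQ.
have lo0 : 0 <= lo by rewrite invr_ge0 ltW.
have hi0 : 0 <= hi by rewrite divr_ge0 // ltW.
pose k : R := 2 * a * #|U|%:R.
have gammaE : gamma = 1 - k * lo ^+ 2 * #|U|%:R.
  by rewrite /gamma /k /lo; field; rewrite !gt_eqF.
have codeg s s' x y : x \in U -> y \in U ->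
    k <= #|[set z in U | adj g s x z && adj g s' y z]|%:R.
  by move=> xU yU; apply: codegree.
have gamma01 : 0 <= gamma <= 1.
  have [x xU] := card_gt0P U0; have := degU true x.
  have : #|nbhd g true x :&: U|%:R <= #|U|%:R :> R.
    by rewrite ler_nat subset_leq_card // subsetIr.
  rewrite -/u => h1 h2; have a1 : a <= 2^-1 by rewrite -(ler_pM2r u0); lra.
  have C1 : 1 <= C%:R :> R.
    by apply: le_trans aC _; rewrite ler_piMl // ltW //; lra.
  have C2 : 1 <= C%:R ^+ 2 :> R by rewrite exprn_ege1.
  rewrite /gamma; apply/andP; split; last first.
    by rewrite lerBlDr lerDl divr_ge0 ?exprn_ge0 // mulr_ge0 // ltW.
  rewrite subr_ge0 ler_pdivrMr ?exprn_gt0 // mul1r; lra.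
pose w s x : R := expR (- lambda * density a0 phi s x).
(* Up to the factor [lambda / #|U|], this is the first-order increase of the potential when the
   neighbourhoods lose [z]. The shrinking of [U] compensates its mean [mu]. *)
pose f (z : V) : R := \sum_s \sum_x w s x * (z \in nbhd g s x)%:R.
pose h : R := potential a0 phi.
have w0 s x : 0 < w s x := expR_gt0 _.
pose mu : R := \sum_s \sum_x w s x * density a0 phi s x.
have dens01 s x : 0 <= density a0 phi s x <= 1.
  rewrite /density divr_ge0 //= ler_pdivrMr // mul1r ler_nat subset_leq_card //.
  exact: subsetIr.
have f01 x : x \in U -> 0 <= f x <= h.
  move=> _; apply/andP; split.
    by do 2!apply: sumr_ge0 => ? _; rewrite mulr_ge0 // ltW.
  apply: ler_sum => s _; apply: ler_sum => y _.
  by rewrite -[leRHS]mulr1 ler_wpM2l ?(ltW (w0 _ _)) // lern1 leq_b1.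
have fmean : \sum_(x in U) f x = #|U|%:R * mu.
  rewrite exchange_big mulr_sumr /=; apply: eq_bigr => s _.
  rewrite exchange_big mulr_sumr /=; apply: eq_bigr => x _.
  rewrite -mulr_sumr [RHS]mulrCA; congr (_ * _).
  rewrite /density -/U mulrCA divff ?mulr1; last by rewrite gt_eqF.
  rewrite -natr_sum; congr (_%:R); rewrite -sum1_card.
  rewrite [RHS](eq_bigl (fun i => (i \in U) && (i \in nbhd g s x))) => [|i]; last first.
    by rewrite !inE andbC.
  by rewrite [RHS]big_mkcondr; apply: eq_bigr => i _; case: (i \in _).
have mu01 : 0 <= mu <= h.
  apply/andP; split.
    apply: sumr_ge0 => s _; apply: sumr_ge0 => y _.
    by rewrite mulr_ge0 ?(ltW (w0 _ _)) //; case/andP: (dens01 s y).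
  apply: ler_sum => s _; apply: ler_sum => y _.
  by rewrite -[leRHS]mulr1 ler_wpM2l ?(ltW (w0 _ _)) //; case/andP: (dens01 s y).
have h_gt0 : 0 < h.
  have [x xU] := card_gt0P U0; rewrite /h /potential (bigD1 true) //= (bigD1 x) //=.
  rewrite -addrA ltr_pwDl ?expR_gt0 // addr_ge0 //.
    by apply: sumr_ge0 => ? _; apply: expR_ge0.
  by do 2!apply: sumr_ge0 => ? _; apply: expR_ge0.
have KK : K%:R <= K%:R ^+ 2 :> R by rewrite expr2; apply: ler_peMl.
have hiE : hi * (C%:R * u) = B%:R by rewrite /hi -/u divfK // gt_eqF // mulr_gt0.
have KEu : 12 * B%:R * K%:R ^+ 2 < eta * (C%:R * u).
  apply: lt_le_trans KE _; rewrite -mulrA ler_pM2l // ler_pM2l //; lra.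
have hiKK : 12 * (hi * K%:R ^+ 2) < eta.
  have p : 0 < C%:R * u by rewrite mulr_gt0.
  rewrite -(ltr_pM2r p).
  have -> : 12 * (hi * K%:R ^+ 2) * (C%:R * u) =
    12 * (hi * (C%:R * u)) * K%:R ^+ 2 by ring.
  by rewrite hiE.
have hiK : hi * K%:R <= 2^-1.
  apply: le_trans (ler_wpM2l hi0 KK) _; move: hiKK eta_le1; set X := hi * _; lra.
(* The excess allowed in an epoch is [eta * K * h]. One third goes to avoiding used vertices, one to
   the unmixed term [gamma ^+ J] and one to the starts of walks, by [KE], [gammaJ] and [rootK]. *)
pose delta := eta / 3 * h.
have deltaK : 2 * (hi * K%:R) * (K%:R * (mu + h)) < delta.
  apply: (@le_lt_trans _ _ (4 * (hi * K%:R ^+ 2) * h)).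
    have -> : 4 * (hi * K%:R ^+ 2) * h = 2 * (hi * K%:R) * (K%:R * (h + h)) by ring.
    rewrite ler_wpM2l ?mulr_ge0 // ler_wpM2l // lerD2r; by case/andP: mu01.
  rewrite /delta ltr_pM2r //; lra.
have root_deg s x : (K < #|nbhd g s x :&: U|)%N.
  rewrite -(ltr_nat R); apply: lt_le_trans (degU s x).
  have a1 : a <= 1.
    by have := dens s x; have /andP[_] := dens01 s x; lra.
  have : 12 * B%:R * K%:R ^+ 2 < a * B%:R * u.
    apply: lt_le_trans KEu _; apply: (@le_trans _ _ (1 * (C%:R * u))).
      by rewrite ler_pM2r // mulr_gt0.
    by rewrite mul1r ler_pM2r //; move: aB C_gt0; set X := a * _; lra.
  have -> : 12 * B%:R * K%:R ^+ 2 = B%:R * (12 * K%:R ^+ 2) :> R by ring.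
  have -> : a * B%:R * u = B%:R * (a * u) by ring.
  rewrite ltr_pM2l // -/u => h1; have h2 : a * u <= u by rewrite ler_piMl // ltW.
  have h3 : 0 <= a * u by rewrite mulr_ge0 // ltW.
  rewrite mulrDl; move: h1 h2 h3 KK u0; set X := a * u; set Y := K%:R ^+ 2; lra.
have b0_le : (a0 + K <= #|V|)%N by apply: leq_trans aE; apply: leq_addr.
have [psi [psiE psi_phi cost]] := epoch pa kQ lo0 hi0 codeg gammaE gamma01 a0_gt0 b0_le
  f01 fmean mu01 J erefl phiE erefl root_deg hiK deltaK.
exists psi; split => //.
pose U' := free (a0 + K) psi; pose u' : R := #|U'|%:R.
have u'E : u' = u - K%:R.
  have c' := card_free psiE; have cK : (K <= #|V| - a0)%N.
    by rewrite leq_subRL // (leq_trans _ b0_le) // leq_addr.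
  by rewrite /u' /U' c' /u cU subnDA natrB.
have u'E0 : E%:R <= u' by rewrite u'E; lra.
have u'0 : 0 < u' by lra.
pose X s x : R := \sum_(a0 <= i < a0 + K) (psi i \in nbhd g s x)%:R.
have XK s x : 0 <= X s x <= K%:R.
  rewrite sumr_ge0 //=; apply: (@le_trans _ _ (\sum_(a0 <= i < a0 + K) 1)).
    by apply: ler_sum => i _; rewrite lern1 leq_b1.
  by rewrite big_const_nat addKn iter_addr_0.
have nbhdX s x : #|nbhd g s x :&: U'|%:R = #|nbhd g s x :&: U|%:R - X s x.
  rewrite !(card_nbhd_free _ psiE, card_nbhd_free _ phiE).
  rewrite (@big_cat_nat _ _ _ a0) ?leq_addr //= -/(X s x) opprD addrA.
  by congr (_ - _ - _); apply: eq_big_nat => i /andP[_ ia]; rewrite psi_phi.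
pose kappa : R := lambda / u'.
have kappa0 : 0 < kappa by rewrite divr_gt0.
(* When [x] loses [X] free neighbours and [U] loses [K] vertices, the density changes by exactly
   [(density * K - X) / u']; [y] is the resulting change of the exponent. *)
pose y s x : R := kappa * (X s x - density a0 phi s x * K%:R).
have potE s x : expR (- lambda * density (a0 + K) psi s x) = w s x * expR (y s x).
  rewrite /w -expRD; congr expR; rewrite /y /kappa /density nbhdX -/U -/U' -/u -/u' u'E.
  have p : u - K%:R != 0 by rewrite -u'E gt_eqF.
  by field; rewrite p gt_eqF.
have kK : kappa * K%:R <= lambda * K%:R / E%:R.
  rewrite /kappa mulrAC ler_pM2l ?mulr_gt0 ?ltr0n // lef_pV2 //.
have kK2 : kappa * K%:R <= 2^-1.
  by apply: le_trans kK _; rewrite ler_pdivrMr.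
have yle s x : y s x <= 2^-1 /\ y s x ^+ 2 <= (kappa * K%:R) ^+ 2.
  have /andP[X0 X1] := XK s x; have /andP[d0 d1] := dens01 s x.
  have h1 : `|X s x - density a0 phi s x * K%:R| <= K%:R.
    rewrite ler_norml; apply/andP; split; nra.
  have h2 : `|y s x| <= kappa * K%:R.
    by rewrite /y normrM gtr0_norm // ler_pM2l.
  split; first by apply: le_trans kK2; apply: le_trans h2; apply: ler_norm.
  by rewrite -(real_normK (num_real (y s x))) lerXn2r ?nnegrE // mulr_ge0 // ltW.
have costE : \sum_(a0 <= i < a0 + K) f (psi i) = \sum_s \sum_x w s x * X s x.
  rewrite exchange_big /=; apply: eq_bigr => s _; rewrite exchange_big /=.
  by apply: eq_bigr => x _; rewrite mulr_sumr.
have drift : \sum_s \sum_x w s x * (X s x - density a0 phi s x * K%:R) <= eta * K%:R * h.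
  have -> : \sum_s \sum_x w s x * (X s x - density a0 phi s x * K%:R) =
      \sum_s \sum_x w s x * X s x - K%:R * mu.
    rewrite /mu mulr_sumr -sumrB; apply: eq_bigr => s _.
    by rewrite mulr_sumr -sumrB; apply: eq_bigr => x _; ring.
  rewrite -costE lerBlDl; apply: le_trans cost _; rewrite -addrA lerD2l.
  have h1 := ler_wpM2r (ler0n R K) gammaJ.
  have h2 : 3 * (walk_cost gamma Delta J * L%:R + gamma ^+ J * K%:R) <= 2 * (eta * K%:R).
    by move: rootK h1; lra.
  have h3 := ler_wpM2l (ltW h_gt0) h2.
  rewrite /delta; move: h3; set Z := walk_cost _ _ _ * _ + _; set Y := eta * K%:R => h3.
  have -> : K%:R * (eta / 3 * h) = Y * h / 3 by rewrite /Y; field.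
  lra.
have h1 : potential (a0 + K) psi <=
    h + kappa * (eta * K%:R * h) + 2 * (kappa * K%:R) ^+ 2 * h.
  apply: (@le_trans _ _ (\sum_s \sum_x (w s x +
      kappa * (w s x * (X s x - density a0 phi s x * K%:R)) +
      2 * (kappa * K%:R) ^+ 2 * w s x))).
    apply: ler_sum => s _; apply: ler_sum => x _; rewrite potE.
    have [y1 y2] := yle s x.
    have := ler_wpM2l (ltW (w0 s x)) (expR_le_quadratic y1) => h1; apply: le_trans h1 _.
    have := ler_wpM2l (ltW (w0 s x)) y2; rewrite /y; lra.
  under eq_bigr do rewrite !big_split /= -!mulr_sumr.
  rewrite !big_split /= -!mulr_sumr -/h lerD2r lerD2l ler_pM2l //.
apply: le_trans h1 _; rewrite -/h.
have -> : h + kappa * (eta * K%:R * h) + 2 * (kappa * K%:R) ^+ 2 * h =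
  h * (1 + (eta * (kappa * K%:R) + 2 * (kappa * K%:R) ^+ 2)) by ring.
rewrite ler_pM2l //; apply: le_trans (expR_ge1Dx _) _; rewrite ler_expR.
have kK0 : 0 <= kappa * K%:R by rewrite mulr_ge0 // ltW.
apply: lerD.
  have -> : lambda * eta * K%:R / E%:R = eta * (lambda * K%:R / E%:R) by ring.
  by rewrite ler_pM2l.
by rewrite ler_pM2l // lerXn2r ?nnegrE // (le_trans kK0).
Qed.

(** Each summand is at most the potential, so a potential of at most [exp (- lambda * (1/2 + a))]
    keeps all densities at least [1/2 + a]. It begins below this by [exp (lambda * a')] apart from
    the factor [2 * #|V|]. Half of this exponent pays for that factor, by [start], and half for all
    epochs together, by [rate]. *)
Lemma almost_spanning (a' : R) (a0 T : nat) (phi : nat -> V) :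
  (0 < a0)%N -> (a0 + T * K + E <= #|V|)%N -> embeds g pi sg a0 phi ->
  (forall s x, 2^-1 + a + a' <= density a0 phi s x) ->
  #|V|%:R * (eta / E%:R + 2 * lambda * K%:R / E%:R ^+ 2) <= a' / 2 ->
  2 * #|V|%:R <= expR (lambda * (a' / 2)) ->
  exists2 psi, embeds g pi sg (a0 + T * K) psi & forall i, (i < a0)%N -> psi i = phi i.
Proof.
move=> a0_gt0 aT phiE dens0 rate start.
pose e0 := lambda * eta * K%:R / E%:R + 2 * (lambda * K%:R / E%:R) ^+ 2.
have E0 : 0 < E%:R :> R by rewrite ltr0n.
suff H t : (t <= T)%N -> exists psi, [/\ embeds g pi sg (a0 + t * K) psi,
    forall i, (i < a0)%N -> psi i = phi i &
    potential (a0 + t * K) psi <= potential a0 phi * expR (t%:R * e0)].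
  by have [psi [psiE psi_phi _]] := H T (leqnn T); exists psi.
elim: t => [|t IH] tT.
  by exists phi; rewrite mul0n addn0 mul0r expR0 mulr1; split.
have [psi [psiE psi_phi le]] := IH (ltnW tT).
have tKT : (t.+1 * K <= T * K)%N by rewrite leq_mul2r tT orbT.
have tE : (a0 + t * K + K + E <= #|V|)%N.
  by apply: leq_trans aT; rewrite leq_add2r -addnA leq_add2l addnC -mulSn.
have dens s x : 2^-1 + a <= density (a0 + t * K) psi s x.
  have h1 : expR (- lambda * density (a0 + t * K) psi s x) <= potential (a0 + t * K) psi.
    rewrite /potential (bigD1 s) //= (bigD1 x) //= -addrA lerDl addr_ge0 //.
      by apply: sumr_ge0 => ? _; apply: expR_ge0.
    by do 2!apply: sumr_ge0 => ? _; apply: expR_ge0.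
  have h2 : potential a0 phi <= 2 * #|V|%:R * expR (- lambda * (2^-1 + a + a')).
    apply: (@le_trans _ _ (\sum_(s : bool) \sum_(x : V) expR (- lambda * (2^-1 + a + a')))).
      apply: ler_sum => b _; apply: ler_sum => z _; rewrite ler_expR !mulNr lerN2.
      by rewrite ler_pM2l.
    by rewrite sumr_const card_bool sumr_const -[X in X <= _]mulr_natl -[X in _ * X <= _]mulr_natl mulrA.
  have tK : t%:R * K%:R <= #|V|%:R :> R.
    by rewrite -natrM ler_nat; move: tE; clear; lia.
  have h3 : t%:R * e0 <= lambda * (a' / 2).
    have -> : t%:R * e0 = lambda * ((t%:R * K%:R) * (eta / E%:R + 2 * lambda * K%:R / E%:R ^+ 2)).
      by rewrite /e0; field; rewrite gt_eqF.
    rewrite ler_pM2l //; apply: le_trans rate; apply: ler_wpM2r tK.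
    by rewrite addr_ge0 ?divr_ge0 ?mulr_ge0 ?exprn_ge0 // ltW.
  have h4 : expR (- lambda * density (a0 + t * K) psi s x) <= expR (- lambda * (2^-1 + a)).
    apply: le_trans h1 _; apply: le_trans le _.
    apply: (@le_trans _ _ (expR (lambda * (a' / 2)) *
      expR (- lambda * (2^-1 + a + a')) * expR (lambda * (a' / 2)))).
      apply: ler_pM; rewrite ?expR_ge0 ?ler_expR //.
        by apply: sumr_ge0 => ? _; apply: sumr_ge0 => ? _; apply: expR_ge0.
      by apply: le_trans h2 _; rewrite ler_pM2r ?expR_gt0.
    by rewrite -!expRD ler_expR le_eqVlt; apply/orP; left; apply/eqP; field.
  by move: h4; rewrite ler_expR !mulNr lerN2 ler_pM2l.
have [psi' [psi'E psi'_psi le']] := epoch_potential (ltn_addr _ a0_gt0) tE psiE dens.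
exists psi'; split.
- by rewrite mulSn [(K + _)%N]addnC addnA.
- by move=> i ia; rewrite psi'_psi ?psi_phi // ltn_addr.
have -> : (a0 + t.+1 * K = a0 + t * K + K)%N by rewrite mulSn [(K + _)%N]addnC addnA.
apply: le_trans le' _; have -> : t.+1%:R * e0 = t%:R * e0 + e0.
  by rewrite -[t.+1%:R]natr1 mulrDl mul1r.
rewrite [expR (t%:R * e0 + e0)]expRD [leRHS]mulrA.
by apply: ler_wpM2r le; apply: expR_ge0.
Qed.
End Almost.

(** * Absorbers *)

Section GreedyRequirements.
Variables (R : realType) (V : finType) (g : rel V).
Variables (pi : nat -> nat) (sg : nat -> bool) (m : nat).
Hypothesis pi_lt : forall i, (0 < i < m)%N -> (pi i < i)%N.
Variables (Rq : finType) (X : seq nat) (block : nat -> seq nat).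
Variables (A : Rq -> nat -> nat -> pred V) (c : R).
Hypothesis uniqX : uniq X.
Hypothesis uniq_block : forall b, b \in X -> uniq (block b).
Hypothesis size_block : forall b, b \in X -> (size (block b) <= 3)%N.
Hypothesis block_pos : forall b j, b \in X -> j \in block b -> (0 < j < m)%N.
Hypothesis block_disj : forall b b' j, b \in X -> b' \in X ->
  j \in block b -> j \in block b' -> b = b'.
Hypothesis c01 : 0 <= c <= 1.
Hypothesis nbhd_avail : forall s x (F : {set V}), (#|F| < m)%N -> (0 < #|nbhd g s x :\: F|)%N.
Hypothesis A_dense : forall r b j s x (F : {set V}), b \in X -> j \in block b ->
  (#|F| < m)%N ->
  c * #|nbhd g s x :\: F|%:R <= #|[set z in nbhd g s x :\: F | A r b j z]|%:R.

(* Conditional probability that the [j]-th vertex meets requirement [r], once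
   the vertices before [i] are placed. *)
Let prob (phi : nat -> V) i r b j : R := if (j < i)%N then (A r b j (phi j))%:R else c.

(** Pessimistic estimator: the conditional expectation of [2^-N], with [N] the number of blocks that
    meet [r], if the unplaced vertices met their conditions independently with probability [c]. *)
Let weight phi i r : R :=
  \prod_(b <- X) (1 - 2^-1 * \prod_(j <- block b) prob phi i r b j).

Let prob01 phi i r b j : 0 <= prob phi i r b j <= 1.
Proof. by rewrite /prob; case: ifP => // _; rewrite ler0n lern1 leq_b1. Qed.

Let prod_prob01 phi i r b (P : pred nat) s : 0 <= \prod_(j <- s | P j) prob phi i r b j <= 1.
Proof.
rewrite prodr_ge0 /= => [|j _]; last by case/andP: (prob01 phi i r b j).
by apply: prodr_ile1 => j _; apply: prob01.
Qed.

(** Blocks are disjoint, so [i] lies in at most one and the weight is affine in a single indicator,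
    with non-positive slope. The mean of this indicator over [Av] is at least [c]. *)
Let weight_step phi i r (Av : {set V}) :
  (forall b, b \in X -> i \in block b -> c * #|Av|%:R <= #|[set z in Av | A r b i z]|%:R) ->
  \sum_(z in Av) weight (update phi i z) i.+1 r <= #|Av|%:R * weight phi i r.
Proof.
move=> dense.
have probE z b j : j != i -> prob (update phi i z) i.+1 r b j = prob phi i r b j.
  by move=> ji; rewrite /prob /update (negbTE ji) ltnS leq_eqVlt (negbTE ji).
have probi z b : prob (update phi i z) i.+1 r b i = (A r b i z)%:R.
  by rewrite /prob ltnS leqnn /update eqxx.
have blockE z b : i \notin block b ->
    \prod_(j <- block b) prob (update phi i z) i.+1 r b j = \prod_(j <- block b) prob phi i r b j.
  by move=> ib; apply: eq_big_seq => j jb; rewrite probE //; apply: contraNneq ib => <-.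
have [/hasP[b0 b0X ib0]|/hasPn none] := boolP (has (fun b => i \in block b) X); last first.
  rewrite (eq_bigr (fun=> weight phi i r)) => [|z _].
    by rewrite sumr_const mulr_natl.
  by apply: eq_big_seq => b /none ib; rewrite blockE.
pose P := \prod_(b <- X | b != b0) (1 - 2^-1 * \prod_(j <- block b) prob phi i r b j).
pose q := \prod_(j <- block b0 | j != i) prob phi i r b0 j.
have P0 : 0 <= P.
  apply: prodr_ge0 => b _; have /andP[_ h] := prod_prob01 phi i r b predT (block b); lra.
have q0 : 0 <= q by have /andP[] := prod_prob01 phi i r b0 (fun j => j != i) (block b0).
have wE : weight phi i r = (1 - 2^-1 * (c * q)) * P.
  rewrite /weight (bigD1_seq b0) //= (bigD1_seq i) ?uniq_block //=.
  by rewrite {1}/prob ltnn.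
have w'E z : weight (update phi i z) i.+1 r = (1 - 2^-1 * ((A r b0 i z)%:R * q)) * P.
  rewrite /weight (bigD1_seq b0) //= (bigD1_seq i) ?uniq_block //= probi.
  congr (_ * _).
    by congr (1 - _ * (_ * _)); apply: eq_bigr => j ji; rewrite probE.
  rewrite big_seq_cond [RHS]big_seq_cond; apply: eq_bigr => b /andP[bX bb0]; rewrite blockE //.
  by apply: contraNN bb0 => ib; apply/eqP; apply: block_disj bX b0X ib ib0.
rewrite (eq_bigr _ (fun z _ => w'E z)) -mulr_suml wE mulrA ler_wpM2r //.
rewrite sumrB sumr_const -mulr_sumr -mulr_suml mulrBr mulr1 lerD2l lerN2.
rewrite -natr_sum (_ : (\sum_(z in Av) A r b0 i z = #|[set z in Av | A r b0 i z]|)%N); last first.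
  rewrite -sum1_card [RHS](eq_bigl (fun z => (z \in Av) && A r b0 i z)) => [|z].
    by rewrite big_mkcondr; apply: eq_bigr => z _; case: (A _ _ _ _).
  by rewrite inE.
have := ler_wpM2r q0 (dense b0 b0X ib0).
rewrite mulrCA ler_pM2l ?invr_gt0 // => h; apply: le_trans h.
by rewrite mulrA [_ * c]mulrC.
Qed.

(** Some admissible image never raises the sum of the estimators over all requirements. The initial
    sum is bounded because blocks have at most 3 vertices; the final estimator of [r] is 2 to the
    minus number of blocks that meet [r]. *)
Lemma greedy_requirements (x0 : V) : exists2 phi, embeds g pi sg m phi &
  forall r, 2^-1 ^+ count (fun b => all (fun j => A r b j (phi j)) (block b)) X
    <= #|Rq|%:R * (1 - 2^-1 * c ^+ 3) ^+ size X.
Proof.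
have /andP[c0 c1] := c01.
suff H i : (i <= m)%N -> exists2 phi, embeds g pi sg i phi &
    \sum_r weight phi i r <= #|Rq|%:R * (1 - 2^-1 * c ^+ 3) ^+ size X.
  have [phi phiE le] := H m (leqnn m); exists phi => // r.
  apply: le_trans le; rewrite (bigD1 r) //= -[leLHS]addr0; apply: lerD; last first.
    apply: sumr_ge0 => r' _; apply: prodr_ge0 => b _.
    by have /andP[_ h] := prod_prob01 phi m r' b predT (block b); lra.
  rewrite le_eqVlt; apply/orP; left; apply/eqP; rewrite /weight.
  have -> : \prod_(b <- X) (1 - 2^-1 * \prod_(j <- block b) prob phi m r b j) =
     \prod_(b <- X) (if all (fun j => A r b j (phi j)) (block b) then 2^-1 else 1).
    apply: eq_big_seq => b bX; case: ifPn => [/allP H'|/allPn[j jb nA]].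
      rewrite big_seq big1 ?mulr1; first by field.
      by move=> j jb; rewrite /prob H' //; case/andP: (block_pos bX jb) => _ ->.
    rewrite (bigD1_seq j) ?uniq_block //= {1}/prob (negbTE nA).
    by case/andP: (block_pos bX jb) => _ ->; rewrite mul0r mulr0 subr0.
  by rewrite -big_mkcond big_const_seq iter_mulr_1.
elim: i => [|i IH] im.
  exists (fun=> x0); first by split=> // i /andP[].
  rewrite -[X in X <= _](_ : \sum_(r in Rq) weight (fun=> x0) 0 r = _) //.
  apply: (@le_trans _ _ (\sum_(r in Rq) (1 - 2^-1 * c ^+ 3) ^+ size X)); last first.
    by rewrite sumr_const mulr_natl.
  apply: ler_sum => r _; rewrite /weight.
  have -> : (1 - 2^-1 * c ^+ 3) ^+ size X = \prod_(b <- X) (1 - 2^-1 * c ^+ 3).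
    by rewrite big_const_seq count_predT iter_mulr_1.
  rewrite big_seq [leRHS]big_seq; apply: ler_prod => b bX.
  have /andP[_ h] := prod_prob01 (fun=> x0) 0 r b predT (block b).
  apply/andP; split; first by lra.
  rewrite lerD2l lerN2 ler_pM2l ?invr_gt0 //.
  have -> : \prod_(j <- block b) prob (fun=> x0) 0 r b j = c ^+ size (block b).
    by rewrite big_const_seq count_predT iter_mulr_1.
  by apply: ler_wiXn2l => //; apply: size_block.
have [phi phiE le] := IH (ltnW im).
have cF : (#|img i phi| < m)%N by rewrite card_img //; case: phiE.
pose N := if i is 0 then [set: V] else nbhd g (sg i) (phi (pi i)).
pose Av := N :\: img i phi.
have Av0 : (0 < #|Av|)%N.
  rewrite /Av /N; case: (i) cF => [|i'] cF; last exact: nbhd_avail.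
  apply/card_gt0P; exists x0; rewrite !inE andbT; apply/negP => /imgP[j].
  by rewrite ltn0.
have step : \sum_(z in Av) \sum_r weight (update phi i z) i.+1 r <= #|Av|%:R * \sum_r weight phi i r.
  rewrite exchange_big mulr_sumr /=; apply: ler_sum => r _; apply: weight_step => b bX ib.
  have /andP[i0 _] := block_pos bX ib.
  have NE : N = nbhd g (sg i) (phi (pi i)) by rewrite /N; case: (i) i0.
  by rewrite /Av NE; apply: A_dense.
have [z zAv lez] : exists2 z, z \in Av & \sum_r weight (update phi i z) i.+1 r <= \sum_r weight phi i r.
  have [/exists_inP//|] := boolP [exists z in Av,
    \sum_r weight (update phi i z) i.+1 r <= \sum_r weight phi i r].
  rewrite negb_exists_in => /forall_inP H; exfalso.
  move: step; apply/negP; rewrite -ltNge mulr_natl -sumr_const.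
  have [z0 z0Av] := card_gt0P Av0.
  rewrite [ltLHS](bigD1 z0) // [ltRHS](bigD1 z0) //=; apply: ltr_leD.
    by rewrite ltNge H.
  by apply: ler_sum => z /andP[/H nle _]; rewrite ltW // ltNge.
exists (update phi i z); last exact: le_trans lez le.
move: zAv; rewrite inE => /andP[zN zNb].
apply: embeds_update => //.
  by move=> _ j /andP[j0 ji]; apply: pi_lt; rewrite j0 (leq_ltn_trans ji).
by move: zNb; rewrite /N; case: (i) => // i'; rewrite inE.
Qed.
End GreedyRequirements.

Local Close Scope ring_scope.

(** * Disjoint blocks around vertices of small degree *)

Lemma count_predU_le (T : Type) (p q : pred T) (s : seq T) :
  count (predU p q) s <= count p s + count q s.
Proof. by rewrite -count_predUI leq_addr. Qed.

(** Greedy selection: a chosen block has at most [k] elements, each in at most [D] blocks, so it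
    excludes at most [k * D] blocks, itself included. *)
Lemma disjoint_subfamily (T U : eqType) (block : T -> seq U) (k D : nat) (s : seq T) :
  uniq s -> (forall b, b \in s -> 0 < size (block b) <= k) ->
  (forall j, count (fun b => j \in block b) s <= D) ->
  exists X : seq T, [/\ uniq X, {subset X <= s},
    forall b b' j, b \in X -> b' \in X -> j \in block b -> j \in block b' -> b = b' &
    size s <= k * D * size X].
Proof.
have [l] := ubnP (size s); elim: l s => // l IH [|b s] /= ltl.
  by exists [::].
move=> /andP[bs us] sizeb countD.
pose meets b' := has (fun j => j \in block b') (block b).
have [||||X [uX Xs Xdis sizeX]] := IH [seq b' <- s | ~~ meets b'].
- by rewrite size_filter; apply: leq_ltn_trans (count_size _ _) _.
- exact: filter_uniq.
- by move=> b'; rewrite mem_filter => /andP[_ b's]; apply: sizeb; rewrite inE b's orbT.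
- move=> j; apply: leq_trans (countD j); rewrite count_filter.
  by apply: leq_trans (leq_addl _ _); apply: sub_count => b' /andP[].
have Xsub b' : b' \in X -> b' \in s /\ ~~ meets b'.
  by move=> /Xs; rewrite mem_filter => /andP[].
exists (b :: X); split.
- by rewrite /= uX andbT; apply: contra bs => /Xsub[].
- by move=> b'; rewrite !inE => /orP[->//|/Xsub[-> _]]; rewrite orbT.
- move=> b1 b2 j; rewrite !inE => /orP[/eqP->|b1X] /orP[/eqP->|b2X] // j1 j2.
  + by have [_ /hasPn/(_ _ j1)] := Xsub _ b2X; rewrite j2.
  + by have [_ /hasPn/(_ _ j2)] := Xsub _ b1X; rewrite j1.
  + exact: Xdis b1X b2X j1 j2.
rewrite /= mulnS -(count_predC meets s) -!size_filter -addSn; apply: leq_add => //.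
have count_sum (r : seq U) :
    count (fun b' => has (fun j => j \in block b') r) (b :: s) <= size r * D.
  elim: r => [|j r IHr]; first by rewrite (eq_count (a2 := pred0)) ?count_pred0.
  rewrite mulSn; apply: leq_trans (leq_add (countD j) IHr).
  exact: (count_predU_le (fun b' => j \in block b') _ (b :: s)).
have /andP[b0 bk] : 0 < size (block b) <= k by apply: sizeb; rewrite inE eqxx.
apply: leq_trans (leq_mul bk (leqnn D)); apply: leq_trans (count_sum (block b)).
rewrite size_filter /= -/(meets b) -add1n leq_add //.
suff -> : meets b by [].
by apply/hasP; case: (block b) b0 => // j r _; exists j; rewrite inE eqxx.
Qed.

Section Blocks.
Variables (Delta L n m : nat) (pi : nat -> nat).
Hypothesis pa : parent_array Delta L n pi.
Hypothesis m_gt0 : 0 < m.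
Hypothesis m_le : m <= n.

Definition children b : seq nat := [seq j <- index_iota 1 n | pi j == b].

Definition block b : seq nat := [:: pi b, b & children b].

(** A single child keeps the block at 3 vertices, and children below [m] keep it inside the initial
    segment. The root may not occur in a block, because its image is not chosen inside a
    neighbourhood. *)
Definition candidate b : bool :=
  [&& 0 < b < m, 0 < pi b, size (children b) <= 1 & all (ltn^~ m) (children b)].

(** Counting edges, at most half of the vertices have two or more children below [m]. Of the others,
    at most [L] have a child beyond [m], at most [Delta] are children of the root, and one is the
    root. *)
Lemma candidates_many : m <= 2 * count candidate (iota 0 m) + 2 * (Delta + L).+1.
Proof.
have [pi_lt ch cross] := pa.
pose many b := 1 < count (fun j => pi j == b) (index_iota 1 m).
pose late b := has (leq m) (children b).
have many_le : 2 * count many (iota 0 m) <= m.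
  rewrite mulnC -sum1_count big_mkcond big_distrl /= -[X in _ <= X]subn0.
  have -> : m - 0 = \sum_(0 <= j < m) 1 by rewrite sum_nat_const_nat muln1.
  apply: (@leq_trans (\sum_(b <- iota 0 m) \sum_(1 <= j < m) (pi j == b))).
    apply: leq_sum => b _; rewrite /many -sum1_count big_mkcond /=.
    rewrite [in leqRHS](eq_bigr (fun j => if pi j == b then 1 else 0)) => [|j _]; last by case: ifP.
    by case: ifP; rewrite ?mul1n.
  rewrite exchange_big /= [leqRHS]big_ltn //; apply: leq_trans (leq_addl _ _).
  rewrite big_nat [leqRHS]big_nat; apply: leq_sum => j /andP[j0 jm].
  rewrite (bigD1_seq (pi j)) ?iota_uniq //=; last first.
    by rewrite mem_iota add0n /=; have := pi_lt j; lia.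
  by rewrite eqxx big1 // => b /negbTE; rewrite eq_sym => ->.
have late_le : count late (iota 0 m) <= L.
  apply: leq_trans (cross m m_gt0); rewrite -!size_filter -(size_map pi).
  apply: uniq_leq_size; first by rewrite filter_uniq ?iota_uniq.
  move=> b; rewrite mem_filter mem_iota add0n /= => /andP[/hasP[j] + mj bm].
  rewrite mem_filter mem_index_iota => /andP[/eqP jb /andP[_ jn]].
  by apply/mapP; exists j; rewrite ?jb // mem_filter mem_index_iota jb bm mj jn.
have root_le : count (fun b => (0 < b) && (pi b == 0)) (iota 0 m) <= Delta.
  apply: leq_trans (ch 0); rewrite -!size_filter.
  apply: uniq_leq_size; first by rewrite filter_uniq ?iota_uniq.
  move=> b; rewrite !mem_filter mem_iota mem_index_iota add0n /= => /andP[/andP[b0 ->] bm].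
  by rewrite b0 (leq_trans bm).
have zero_le : count (pred1 0) (iota 0 m) <= 1.
  by rewrite count_uniq_mem ?iota_uniq ?leq_b1.
have cover : m <= count candidate (iota 0 m) + (count many (iota 0 m) +
    (count late (iota 0 m) + (count (fun b => (0 < b) && (pi b == 0)) (iota 0 m) +
      count (pred1 0) (iota 0 m)))).
  have U p q := count_predU_le p q (iota 0 m).
  rewrite -{1}(size_iota 0 m) -count_predT.
  apply: leq_trans (leq_add (leqnn _) (leq_trans (U _ _)
    (leq_add (leqnn _) (leq_trans (U _ _) (leq_add (leqnn _) (U _ _)))))).
  apply: leq_trans (U _ _); rewrite -!size_filter; apply: uniq_leq_size.
    by rewrite filter_uniq ?iota_uniq.
  move=> b; rewrite !mem_filter mem_iota add0n /= => bm; rewrite bm andbT.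
  rewrite -[X in is_true X]/([|| candidate b, many b, late b, (0 < b) && (pi b == 0) | b == 0]).
  have [->|b0] := posnP b; first by rewrite !orbT.
  have [_|p0] := posnP (pi b); first by rewrite /= !orbT.
  have [_|nlb] := boolP (late b); first by rewrite /= !orbT.
  have allm : all (ltn^~ m) (children b).
    by apply/allP => j jb /=; rewrite ltnNge; apply: contra nlb => mj; apply/hasP; exists j.
  have [_|nm] := boolP (many b); first by rewrite /= !orbT.
  rewrite /candidate b0 bm p0 allm /= andbT; apply/orP; left.
  move: nm; rewrite -leqNgt; apply: leq_trans; rewrite -size_filter.
  apply: uniq_leq_size; first by rewrite filter_uniq ?iota_uniq.
  move=> j jb; have jm : j < m := allP allm j jb; move: jb.
  by rewrite !mem_filter !mem_index_iota jm => /and3P[-> -> _].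
lia.
Qed.

(** A vertex lies only in its own block, those of its at most [Delta] children and that of its
    parent, so [disjoint_subfamily] applies with multiplicity [Delta.+2]. *)
Lemma blocks_exist : exists X : seq nat,
  [/\ uniq X, {subset X <= [pred b | candidate b]},
    forall b b' j, b \in X -> b' \in X -> j \in block b -> j \in block b' -> b = b' &
    m <= 6 * Delta.+2 * size X + 2 * (Delta + L).+1].
Proof.
have [pi_lt ch cross] := pa.
have [|b|j|X [uX Xs Xd sX]] := @disjoint_subfamily _ _ block 3 Delta.+2 [seq b <- iota 0 m | candidate b].
- by rewrite filter_uniq ?iota_uniq.
- by rewrite mem_filter => /andP[/and4P[_ _ h _] _] /=.
- rewrite count_filter.
  apply: (@leq_trans (count (pred1 j) (iota 0 m) +
      (count (fun b => (0 < b) && (pi b == j)) (iota 0 m) + count (pred1 (pi j)) (iota 0 m)))).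
    apply: leq_trans (leq_add (leqnn _)
      (_ : count (predU (fun b => (0 < b) && (pi b == j)) (pred1 (pi j))) (iota 0 m) <= _));
      last first.
      by rewrite -count_predUI leq_addr.
    rewrite -[leqRHS]count_predUI; apply: leq_trans (leq_addr _ _).
    apply: sub_count => b /=; rewrite /block !inE => /andP[+ /and4P[/andP[b0 _] _ _ _]].
    rewrite b0 mem_filter => /or3P[/eqP->|/eqP->|/andP[/eqP-> _]]; by rewrite eqxx ?orbT.
  have h1 k : count (pred1 k) (iota 0 m) <= 1.
    by rewrite count_uniq_mem ?iota_uniq ?leq_b1.
  have h2 : count (fun b => (0 < b) && (pi b == j)) (iota 0 m) <= Delta.
    apply: leq_trans (ch j); rewrite -!size_filter.
    apply: uniq_leq_size; first by rewrite filter_uniq ?iota_uniq.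
    move=> b; rewrite !mem_filter mem_iota mem_index_iota add0n /= => /andP[/andP[b0 ->] bm].
    by rewrite b0 (leq_trans bm).
  by have := h1 j; have := h1 (pi j); move: h2; clear; lia.
exists X; split=> //.
  by move=> b /Xs; rewrite mem_filter => /andP[].
have h := candidates_many; rewrite -size_filter in h.
apply: leq_trans h _; rewrite leq_add2r -[6]/(2 * 3) -!mulnA leq_mul2l /=.
by rewrite mulnA.
Qed.
End Blocks.

Local Open Scope ring_scope.

(** * Existence and use of absorbers *)

Section Absorption.
Variables (V : finType) (g : rel V).
Variables (Delta L : nat) (pi : nat -> nat) (sg : nat -> bool) (m : nat).
Hypothesis pa : parent_array Delta L #|V| pi.
Hypothesis m_gt0 : (0 < m)%N.
Hypothesis m_le : (m <= #|V|)%N.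

Local Notation children := (children #|V| pi).
Local Notation block := (block #|V| pi).
Local Notation candidate := (candidate #|V| m pi).

(* If [b] absorbs [v] for [(x, s)], then [v] can take over the role of [b],
   which makes [phi b] available as an [s]-neighbour of [x]. *)
Definition absorbs (phi : nat -> V) (x : V) (s : bool) (v : V) (b : nat) : bool :=
  [&& adj g s x (phi b), adj g (sg b) (phi (pi b)) v &
      all (fun j => adj g (sg j) v (phi j)) (children b)].

Let pi_lt i : (0 < i < #|V|)%N -> (pi i < i)%N.
Proof. by have [h _ _] := pa; apply: h. Qed.

Let block_facts b : candidate b ->
  [/\ (0 < b < m)%N, (0 < pi b < b)%N, uniq (block b), (size (block b) <= 3)%N &
      forall j, j \in children b -> [/\ (b < j < m)%N & pi j = b]].
Proof.
move=> /and4P[/andP[b0 bm] p0 sz /allP lt].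
have bV : (0 < b < #|V|)%N by rewrite b0 (leq_trans bm).
have pb := pi_lt bV.
have ch j : j \in children b -> [/\ (b < j < m)%N & pi j = b].
  move=> jb; have jm : (j < m)%N := lt j jb; rewrite jm.
  move: jb; rewrite mem_filter mem_index_iota => /andP[/eqP jb j1].
  by split=> //; rewrite andbT -jb pi_lt.
suff u : uniq (block b) by split; rewrite ?b0 ?p0.
rewrite /= inE negb_or neq_ltn pb /= filter_uniq ?iota_uniq // andbT.
apply/andP; split; apply/negP => /ch[/andP[lt1 _] _].
  by move: (ltn_trans pb lt1); rewrite ltnn.
by rewrite ltnn in lt1.
Qed.

(** The requirements are the [2 * #|V| ^ 2] triples [(x, s, v)]. With at least [k * q] blocks the
    sum of the estimators is at most [2 * #|V| ^ 2 * 4^-k], which is less than [2^-k], so no triple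
    has fewer than [k] absorbers. *)
Lemma absorbers_exist (R : realType) (alpha : R) (q k : nat) :
  0 < alpha <= 2^-1 -> m%:R <= alpha * #|V|%:R ->
  (forall s x, (2^-1 + alpha) * #|V|%:R <= #|nbhd g s x|%:R) ->
  (1 - 2^-1 * alpha ^+ 3) ^+ q <= 4^-1 ->
  (6 * Delta.+2 * (k * q) + 2 * (Delta + L).+1 <= m)%N ->
  (2 * #|V| ^ 2 < 2 ^ k)%N ->
  exists phi X, [/\ embeds g pi sg m phi, uniq X, {subset X <= [pred b | candidate b]},
    forall b b' j, b \in X -> b' \in X -> j \in block b -> j \in block b' -> b = b' &
    forall x s v, (k <= count (absorbs phi x s v) X)%N].
Proof.
move=> /andP[a0 a1] ma degV hq hk hV.
have [X [uX Xc Xd sX]] := blocks_exist pa m_gt0 m_le.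
have V0 : (0 < #|V|)%N := leq_trans m_gt0 m_le.
have [x0 _] := card_gt0P V0.
(* [absorbs] splits into one condition per vertex of the block. Each is membership in a
   neighbourhood, so it holds for at least [2 * alpha * #|V| - m] of the available images. *)
pose A (r : V * bool * V) (b j : nat) : pred V := fun z =>
  if j == b then adj g r.1.2 r.1.1 z
  else if j == pi b then adj g (sg b) z r.2 else adj g (sg j) r.2 z.
have A_nbhd r b j : exists s' y, A r b j =1 [in nbhd g s' y].
  rewrite /A; case: eqP => _; first by exists r.1.2, r.1.1 => z; rewrite inE.
  case: eqP => _; last by exists (sg j), r.2 => z; rewrite inE.
  by exists (~~ sg b), r.2 => z; rewrite inE adjC.
have c01 : 0 <= alpha <= 1 by rewrite ltW //=; lra.
have Fle (F : {set V}) : (#|F| < m)%N -> #|F|%:R <= alpha * #|V|%:R.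
  by move=> /ltnW Fm; apply: le_trans ma; rewrite ler_nat.
have cardD s x (F : {set V}) : #|nbhd g s x :\: F|%:R = #|nbhd g s x|%:R - #|nbhd g s x :&: F|%:R :> R.
  by apply/eqP; rewrite eq_sym subr_eq -natrD addnC cardsID.
have V0R : 0 < #|V|%:R :> R by rewrite ltr0n.
have avail s x (F : {set V}) : (#|F| < m)%N -> (0 < #|nbhd g s x :\: F|)%N.
  move=> Fm; rewrite -(ltr_nat R) cardD subr_gt0.
  apply: lt_le_trans (degV s x).
  have h : #|nbhd g s x :&: F|%:R <= #|F|%:R :> R by rewrite ler_nat subset_leq_card // subsetIr.
  apply: le_lt_trans (le_trans h (Fle F Fm)) _; rewrite mulrDl; nra.
have dense r b j s x (F : {set V}) : b \in X -> j \in block b -> (#|F| < m)%N ->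
    alpha * #|nbhd g s x :\: F|%:R <= #|[set z in nbhd g s x :\: F | A r b j z]|%:R.
  move=> _ _ Fm; have [s' [y Ay]] := A_nbhd r b j.
  have -> : [set z in nbhd g s x :\: F | A r b j z] = (nbhd g s x :&: nbhd g s' y) :\: F.
    by apply/setP => z; rewrite in_set Ay !inE -andbA.
  have h1 := degV s x; have h2 := degV s' y.
  have h3 := cardsUI (nbhd g s x) (nbhd g s' y).
  move/(congr1 (fun k => k%:R : R)): h3; rewrite !natrD => h3.
  have h4 : #|nbhd g s x :|: nbhd g s' y|%:R <= #|V|%:R :> R by rewrite ler_nat max_card.
  have h5 := cardsID F (nbhd g s x :&: nbhd g s' y).
  move/(congr1 (fun k => k%:R : R)): h5; rewrite !natrD => h5.
  have h6 : #|nbhd g s x :&: nbhd g s' y :&: F|%:R <= #|F|%:R :> R.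
    by rewrite ler_nat subset_leq_card // subsetIr.
  have h7 := Fle F Fm.
  have h8 : alpha * #|nbhd g s x :\: F|%:R <= alpha * #|V|%:R.
    by rewrite ler_pM2l // ler_nat max_card.
  lra.
have bpos b j : b \in X -> j \in block b -> (0 < j < m)%N.
  move=> /Xc/block_facts[/andP[b0 bm] /andP[p0 pb] _ _ ch].
  rewrite !inE => /or3P[/eqP->|/eqP->|/ch[/andP[bj jm] _]].
  - by rewrite p0 (ltn_trans pb).
  - by rewrite b0.
  - by rewrite jm andbT (leq_trans _ bj).
have bu b : b \in X -> uniq (block b) by move=> /Xc/block_facts[].
have bs b : b \in X -> (size (block b) <= 3)%N by move=> /Xc/block_facts[].
have pl i : (0 < i < m)%N -> (pi i < i)%N.
  by move=> /andP[i0 im]; apply: pi_lt; rewrite i0 (leq_trans im).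
have [phi phiE H] := greedy_requirements sg pl uX bu bs bpos Xd c01 avail dense x0.
exists phi, X; split=> // x s v; rewrite leqNgt; apply/negP => lt.
have AE : {in X, (fun b => all (fun j => A (x, s, v) b j (phi j)) (block b)) =1 absorbs phi x s v}.
  move=> b /Xc/block_facts[_ /andP[_ pb] _ _ ch]; rewrite /absorbs /= /A /= eqxx.
  rewrite (ltn_eqF pb) eqxx andbCA; congr [&& _, _ & _].
  apply: eq_in_all => j /ch[/andP[bj _] _].
  by rewrite (gtn_eqF bj) (gtn_eqF (ltn_trans pb bj)).
have := H (x, s, v); rewrite (eq_in_count AE).
set cnt := count _ _ in lt *.
have r01 : 0 <= 1 - 2^-1 * alpha ^+ 3 <= 1.
  have h0 : 0 <= alpha ^+ 3 by rewrite exprn_ge0 // ltW.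
  have h1 : alpha ^+ 3 <= 1 by case/andP: c01 => *; apply: exprn_ile1.
  by apply/andP; split; lra.
have /andP[r0 r1] := r01.
have kq : (k * q <= size X)%N.
  by rewrite -(@leq_pmul2l (6 * Delta.+2)) // -(leq_add2r (2 * (Delta + L).+1)) (leq_trans hk).
have h1 : (1 - 2^-1 * alpha ^+ 3) ^+ size X <= 4^-1 ^+ k.
  apply: (@le_trans _ _ ((1 - 2^-1 * alpha ^+ 3) ^+ (k * q))).
    by apply: ler_wiXn2l.
  rewrite mulnC exprM; by apply: lerXn2r hq; rewrite ?nnegrE ?exprn_ge0 ?invr_ge0.
have h2 : 2^-1 ^+ k <= 2^-1 ^+ cnt :> R.
  by apply: ler_wiXn2l; rewrite ?invr_ge0 // ?(ltnW lt) //; lra.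
move=> h3; have : 2^-1 ^+ k <= (2 * #|V| ^ 2)%:R * 4^-1 ^+ k :> R.
  apply: le_trans h2 _; apply: le_trans h3 _.
  rewrite !card_prod card_bool mulnAC [(_ * 2)%N]mulnC; apply: ler_wpM2l => //.
apply/negP; rewrite -ltNge.
have -> : 4^-1 ^+ k = (2^-1 ^+ k) * (2^-1 ^+ k) :> R.
  by rewrite -exprMn; congr (_ ^+ k); field.
rewrite mulrA gtr_pMl ?exprn_gt0 //; last by rewrite invr_gt0.
by rewrite exprVn ltr_pdivrMr ?exprn_gt0 // mul1r -natrX ltr_nat.
Qed.

(** [Y] lists the absorbers not yet used. A swap changes only the image of [b], and by disjointness
    the blocks of the remaining members of [Y] keep the images under [phi] for which they absorb. At
    most [k] swaps occur, so one absorber is always left. *)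
Lemma absorb_all (m' k : nat) (phi psi : nat -> V) (X : seq nat) :
  (m <= m' <= #|V|)%N -> (#|V| - m' <= k)%N ->
  uniq X -> {subset X <= [pred b | candidate b]} ->
  (forall b b' j, b \in X -> b' \in X -> j \in block b -> j \in block b' -> b = b') ->
  (forall x s v, (k <= count (absorbs phi x s v) X)%N) ->
  embeds g pi sg m' psi -> (forall i, (i < m)%N -> psi i = phi i) ->
  exists theta, embeds g pi sg #|V| theta.
Proof.
move=> /andP[mm' m'V] Vk uX Xc Xd abs psiE psi_phi.
suff H l : (m' + l <= #|V|)%N -> exists theta Y, [/\ embeds g pi sg (m' + l) theta, uniq Y,
    {subset Y <= X}, forall b j, b \in Y -> j \in block b -> theta j = phi j &
    forall p, (count p X <= count p Y + l)%N].
  by have [|theta [Y []]] := H (#|V| - m')%N; rewrite subnKC // => thetaE; exists theta.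
have block_lt b j : b \in X -> j \in block b -> (j < m)%N.
  move=> /Xc/block_facts[/andP[b0 bm] /andP[p0 pb] _ _ ch].
  by rewrite !inE => /or3P[/eqP->|/eqP->|/ch[/andP[bj jm] _]] //; apply: ltn_trans bm.
elim: l => [|l IH] lV.
  exists psi, X; rewrite addn0; split=> // [b j bX jb|p]; last by rewrite addn0.
  by apply: psi_phi; apply: block_lt jb.
rewrite addnS in lV *; have [theta [Y [thetaE uY YX theta_phi countY]]] := IH (ltnW lV).
move: thetaE lV; have [i iE] : exists i, i = (m' + l)%N by exists (m' + l)%N.
rewrite -iE => thetaE iV; have [inj edges] := thetaE.
have mi : (m <= i)%N by rewrite iE (leq_trans mm') // leq_addr.
have [v vN] : exists v, v \notin img i theta.
  have : (0 < #|~: img i theta|)%N by rewrite cardsCs setCK card_img // subn_gt0.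
  by move=> /card_gt0P[v]; rewrite inE; exists v.
have : (0 < count (absorbs phi (theta (pi i)) (sg i) v) Y)%N.
  rewrite -(ltn_add2r l) add0n; apply: leq_trans (countY _).
  apply: leq_trans (abs _ _ _); apply: leq_trans Vk.
  by rewrite -(ltn_add2l m') subnKC // -iE.
rewrite -has_count => /hasP[b bY /and3P[adjb adjp /allP adjc]].
have bX := YX b bY; have [/andP[b0 bm] /andP[p0 pb] _ _ ch] := block_facts (Xc b bX).
have bb : b \in block b by rewrite !inE eqxx orbT.
have bi : (b < i)%N := leq_trans bm mi.
have bE : theta b = phi b := theta_phi b b bY bb.
have pbE : theta (pi b) = phi (pi b) by apply: (theta_phi b) => //; rewrite !inE eqxx.
have chE j : j \in children b -> theta j = phi j.
  by move=> jb; apply: (theta_phi b) => //; rewrite !inE jb !orbT.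
have vneq j : (j < i)%N -> theta j <> v.
  by move=> ji jv; case/negP: vN; rewrite -jv mem_img.
have iV0 : (0 < i < #|V|)%N by rewrite iV andbT (leq_trans m_gt0 mi).
have pii := pi_lt iV0.
pose theta' := update (update theta b v) i (theta b).
have old j : j != b -> (j < i)%N -> theta' j = theta j.
  by move=> jb ji; rewrite /theta' /update (ltn_eqF ji) (negbTE jb).
have new_b : theta' b = v by rewrite /theta' /update (ltn_eqF bi) eqxx.
have new_i : theta' i = theta b by rewrite /theta' /update eqxx.
have mem_children j : (0 < j < #|V|)%N -> pi j = b -> j \in children b.
  by move=> jV jb; rewrite mem_filter jb eqxx mem_index_iota.
exists theta', (rem b Y); split.
- split.
    move=> j1 j2; rewrite !ltnS (leq_eqVlt j1) (leq_eqVlt j2).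
    have [->|n1] := eqVneq j1 i; have [->|n2] := eqVneq j2 i => //=; rewrite ?new_i.
    + move=> _ j2i; have [->|n] := eqVneq j2 b; first by rewrite new_b => /(vneq b bi).
      by rewrite old // => /(inj _ _ bi j2i) e; rewrite -e eqxx in n.
    + move=> j1i _; have [->|n] := eqVneq j1 b; first by rewrite new_b => /esym/(vneq b bi).
      by rewrite old // => /(inj _ _ j1i bi) e; rewrite e eqxx in n.
    + move=> j1i j2i; have [->|k1] := eqVneq j1 b; have [->|k2] := eqVneq j2 b => //.
      * by rewrite new_b old // => /esym/(vneq _ j2i).
      * by rewrite new_b old // => /(vneq _ j1i).
      * by rewrite !old //; apply: inj.
  move=> j /andP[j0]; rewrite ltnS leq_eqVlt => /predU1P[->|ji].
    (* The parent of [i] has not moved: it is not [b], whose children all lie below [m]. *)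
    rewrite new_i old ?bE //; apply: contraTneq mi => pib.
    have := mem_children i iV0 pib => /ch[/andP[_ im] _].
    by rewrite -ltnNge.
  have jV : (0 < j < #|V|)%N by rewrite j0 (ltn_trans ji).
  have pj := pi_lt jV.
  have [jb|jb] := eqVneq j b.
    by rewrite jb new_b old ?pbE // ?(ltn_trans pb bi) // ltn_eqF.
  have [pjb|pjb] := eqVneq (pi j) b.
    by have jc := mem_children j jV pjb; rewrite pjb new_b old // chE //; apply: adjc.
  by rewrite !old ?edges ?j0 // (ltn_trans pj).
- exact: rem_uniq.
- by move=> b' /mem_rem/YX.
- move=> b' j; rewrite mem_rem_uniq // !inE => /andP[b'b b'Y] jb'.
  rewrite old ?(theta_phi b') //.
    by apply: contraNneq b'b => jb; rewrite (Xd b' b j) ?YX ?jb //; rewrite -jb.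
  by apply: leq_trans mi; apply: block_lt jb'; apply: YX.
- move=> p; apply: leq_trans (countY p) _.
  rewrite addnS -addSn leq_add2r (permP (perm_to_rem bY)) /= -add1n leq_add2r.
  exact: leq_b1.
Qed.
End Absorption.

(** * Choice of the constants *)

Lemma nat_above (R : realType) (x : R) : exists k : nat, x <= k%:R.
Proof.
exists (Num.Def.archi_bound `|x|); apply: le_trans (ler_norm x) _.
by apply: ltW; apply: archi_boundP.
Qed.

Lemma small_power (R : realType) (x eps : R) : 0 < x <= 1 -> 0 < eps ->
  exists k : nat, (1 - x) ^+ k <= eps.
Proof.
move=> /andP[x0 x1] e0; have [k kP] := nat_above ((eps * x)^-1).
exists k; have h1 : 1 - x <= expR (- x) := expR_ge1Dx (- x).
have h2 : (1 - x) ^+ k <= expR (- (k%:R * x)).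
  rewrite -mulrN expRM_natl; apply: lerXn2r; rewrite ?nnegrE ?expR_ge0 //; lra.
apply: le_trans h2 _; rewrite expRN.
have h3 : eps^-1 <= expR (k%:R * x).
  apply: le_trans (_ : k%:R * x <= _).
    by rewrite -ler_pdivrMr // -invfM.
  by apply: le_trans (expR_ge1Dx _); rewrite lerDr.
by rewrite -[eps]invrK lef_pV2 // posrE ?invr_gt0 // expR_gt0.
Qed.

Lemma log_square_le (N : nat) : exists n0, forall n, (n0 <= n)%N ->
  (N * (trunc_log 2 n).+2 ^ 2 <= n)%N.
Proof.
have cube l : (l.+2 ^ 3 <= 32 * 2 ^ l)%N.
  elim: l => // -[|[|l]] // IH.
  rewrite (expnS 2 l.+2) mulnCA; apply: leq_trans (leq_mul (leqnn 2) IH).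
  rewrite !expnS expn0 !muln1; nia.
(* Such [n] have [32 * N <= l], which turns [32 * N] times the square into at most the cube. *)
exists (2 ^ (32 * N))%N => n n0n; set l := trunc_log 2 n.
have n_gt0 : (0 < n)%N by apply: leq_trans n0n; rewrite expn_gt0.
have lN : (32 * N <= l)%N by apply: trunc_log_max.
have ln : (2 ^ l <= n)%N by apply: trunc_logP.
apply: leq_trans ln; rewrite -(@leq_pmul2l 32) //; apply: leq_trans (cube l).
by rewrite mulnA [(l.+2 ^ 3)%N]expnS leq_mul2r (leq_trans lN) ?orbT // ltnW.
Qed.

Lemma parent_array_embeds (R : realType) (Delta : nat) (alpha : R) :
  0 < alpha <= 2^-1 ->
  exists n0 : nat, forall (V : finType) (g : rel V) (pi : nat -> nat) (sg : nat -> bool),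
    (n0 <= #|V|)%N ->
    (forall s x, (2^-1 + alpha) * #|V|%:R <= #|nbhd g s x|%:R) ->
    parent_array Delta (Delta * (trunc_log 2 #|V|).+1) #|V| pi ->
    exists theta, embeds g pi sg #|V| theta.
Proof.
move=> alphaP; have /andP[al0 al1] := alphaP.
(* Of the surplus alpha, half is kept for the kernels, a quarter is room for the growth of the
   potential, and a quarter pays for the initial segment of at most [alpha / 4 * #|V|] vertices. *)
pose a := alpha / 2; pose a' := alpha / 4.
have a0 : 0 < a by rewrite divr_gt0.
have a'0 : 0 < a' by rewrite divr_gt0.
have [p pP] := nat_above (4 / alpha).
have pP' : 4 <= alpha * p%:R by rewrite mulrC -ler_pdivrMr.
have p2 : (2 <= p)%N by rewrite -(ler_nat R); nra.
have [C CP] := nat_above a^-1.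
have aC : 1 <= a * C%:R by rewrite mulrC -ler_pdivrMr // div1r.
have [B BP] := nat_above (2 * C%:R / a).
have aB : 2 * C%:R <= a * B%:R by rewrite [a * _]mulrC -ler_pdivrMr.
have C1 : 1 <= C%:R :> R by apply: le_trans aC _; rewrite ler_piMl //; rewrite /a; lra.
have C2 : 1 <= C%:R ^+ 2 :> R by rewrite exprn_ege1.
have al3 : 0 < 2^-1 * alpha ^+ 3 <= 1.
  have h0 : 0 < alpha ^+ 3 by rewrite exprn_gt0.
  have h1 : alpha ^+ 3 <= 1 by apply: exprn_ile1; [exact: ltW | lra].
  by apply/andP; split; lra.
have [q qP] : exists q : nat, (1 - 2^-1 * alpha ^+ 3) ^+ q <= 4^-1.
  by apply: small_power => //; rewrite invr_gt0.
have q0 : (0 < q)%N by rewrite lt0n; apply/eqP => q0; move: qP; rewrite q0 expr0; lra.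
(* Here [48 = 4 * 6 * 2]: with [E = #|V| %/ c1], the blocks for [2 * E] absorbers per triple need
   about a quarter of the initial segment. *)
pose c1 := (48 * p * Delta.+2 * q)%N.
have p0 : (0 < p)%N by apply: leq_trans p2.
have c1_ge2 : (2 <= c1)%N.
  by rewrite /c1 -!mulnA; apply: (@leq_trans (48 * 1)); rewrite // leq_mul2l /= !muln_gt0 p0.
have c1R : 2 <= c1%:R :> R by rewrite (ler_nat R 2).
(* Since [#|V| <= 2 * c1 * E], the drift over all epochs is at most [2 * c1 * eta = a' / 4], half of
   what [rate] allows. *)
pose eta : R := a' / (8 * c1%:R).
have eta0 : 0 < eta by rewrite divr_gt0 // mulr_gt0 //; lra.
have eta1 : eta <= 1.
  rewrite ler_pdivrMr ?mul1r; last by lra.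
  by rewrite /a'; lra.
pose gamma : R := 1 - 2 * a / C%:R ^+ 2.
have x01 : 0 < 2 * a / C%:R ^+ 2 <= 1.
  have C20 : 0 < C%:R ^+ 2 :> R by lra.
  apply/andP; split; first by rewrite divr_gt0 // mulr_gt0.
  by rewrite ler_pdivrMr // mul1r; apply: le_trans C2; rewrite /a; lra.
have gamma01 : 0 <= gamma <= 1 by rewrite /gamma; lra.
have [J JP] : exists J : nat, gamma ^+ J <= eta / 3.
  by apply: (small_power x01); rewrite divr_gt0.
have gammaJ : 3 * gamma ^+ J <= eta by lra.
pose W : R := walk_cost gamma Delta J.
have W0 : 0 <= W by apply: root_cost_ge0.
(* [k0] is the ratio of the epoch length to the logarithm, large enough for the starts of walks to
   cost at most a third of [eta * K]. *)
have [k1 k1P] := nat_above (3 * W * Delta%:R / eta).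
pose k0 := k1.+1.
have k0P : 3 * W * Delta%:R <= eta * k0%:R.
  by rewrite [eta * _]mulrC -ler_pdivrMr // (le_trans k1P) // ler_nat leqnSn.
have k0R : 1 <= k0%:R :> R by rewrite ler1n.
(* [n1], [n2] and [n3] make [E] large against the squared logarithm, respectively for avoiding used
   vertices, for small exponents, and for the second-order term of [rate]. *)
have [n1 n1P] := nat_above (12 * B%:R * k0%:R ^+ 2 / (eta * C%:R)).
have [n2 n2P] := nat_above (4 * k0%:R / a').
have [n3 n3P] := nat_above (32 * c1%:R * k0%:R / a' ^+ 2).
pose N0 := (n1.+1 + n2 + n3 + k0 + 8 * p * Delta.+1 + p)%N.
have [leN1 leN2 leN3 leNk] : [/\ n1.+1 <= N0, n2 <= N0, n3 <= N0 & k0 <= N0]%N.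
  by rewrite /N0; set X := (8 * p * _)%N; clear; split; lia.
have [leNp leND leN] : [/\ p <= N0, 8 * p * Delta.+1 <= N0 & 1 <= N0]%N.
  by rewrite /N0; set X := (8 * p * _)%N; clear; split; lia.
have [n0 n0P] := log_square_le (c1 * N0).
exists n0 => V g pi sg n0V degV pa.
have := n0P _ n0V; set l := (trunc_log 2 #|V|).+2 => lV.
have l1 : (0 < l)%N by [].
pose E := (#|V| %/ c1)%N.
have c10 : (0 < c1)%N by apply: leq_trans c1_ge2.
have EN : (N0 * l ^ 2 <= E)%N by rewrite leq_divRL // mulnC mulnA.
have ll2 : (l <= l ^ 2)%N by rewrite -{1}[l]muln1 expnS expn1 leq_mul2l.
have l2 : (1 <= l ^ 2)%N by rewrite expn_gt0.
have N0E x : (x <= N0)%N -> (x * l <= E)%N.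
  by move=> xN; apply: leq_trans EN; apply: leq_mul.
have N0l2 (x : nat) : (x <= N0)%N -> x%:R * l%:R ^+ 2 <= E%:R :> R.
  by move=> xN; rewrite -natrX -natrM ler_nat; apply: leq_trans EN; apply: leq_mul.
have lE : (l <= E)%N by rewrite -[l]mul1n N0E.
have E0 : (0 < E)%N := leq_trans l1 lE.
have EV : (E * c1 <= #|V|)%N := leq_trunc_div _ _.
have VE : (#|V| < E.+1 * c1)%N by rewrite ltn_ceil.
have pE : (p <= E)%N.
  by apply: leq_trans (N0E p leNp); rewrite leq_pmulr.
have E_le : (E <= #|V|)%N by apply: leq_trans EV; rewrite leq_pmulr.
pose m := (#|V| %/ p)%N.
have mV : (m * p <= #|V|)%N := leq_trunc_div _ _.
have Vm : (#|V| < m.+1 * p)%N by rewrite ltn_ceil.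
have m0 : (0 < m)%N by rewrite divn_gt0 // (leq_trans pE).
have mEV : (m + E <= #|V|)%N.
  have h1 : (2 * m <= #|V|)%N by apply: leq_trans mV; rewrite mulnC leq_mul2l p2 orbT.
  have h2 : (2 * E <= #|V|)%N by apply: leq_trans EV; rewrite mulnC leq_mul2l c1_ge2 orbT.
  by move: h1 h2; clear; lia.
pose K := (k0 * l)%N.
have K0 : (0 < K)%N by rewrite muln_gt0.
have KE : (K <= E)%N by apply: N0E.
have lR1 : 1 <= l%:R :> R by rewrite ler1n.
have ER : 0 < E%:R :> R by rewrite ltr0n.
have V0R : 0 < #|V|%:R :> R by rewrite ltr0n (leq_trans E0).
have malpha : m%:R <= alpha * #|V|%:R / 4.
  have h : m%:R * p%:R <= #|V|%:R :> R by rewrite -natrM ler_nat.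
  have := ler_wpM2l (ltW al0) h.
  have := ler_wpM2r (ler0n R m) pP'; lra.
have hk : (6 * Delta.+2 * (2 * E * q) + 2 * (Delta + Delta * (trunc_log 2 #|V|).+1).+1 <= m)%N.
  have h1 : (4 * p * (6 * Delta.+2 * (2 * E * q)) <= #|V|)%N.
    by apply: leq_trans EV; rewrite /c1; apply: eq_leq; ring.
  have h2 : (4 * p * (2 * (Delta + Delta * (trunc_log 2 #|V|).+1).+1) <= #|V|)%N.
    apply: leq_trans E_le; apply: leq_trans (N0E (8 * p * Delta.+1)%N leND).
    rewrite -mulnS -/l -[leqRHS]mulnA.
    apply: (@leq_trans (8 * p * (Delta * l).+1)); first by apply: eq_leq; ring.
    by rewrite leq_mul2l; apply/orP; right; rewrite (mulSn Delta); apply: (leq_add l1).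
  move: h1 h2; set A1 := (6 * _ * _)%N; set A2 := (2 * _.+1)%N => h1 h2.
  have h3 : (2 * (A1 + A2) * p < m.+1 * p)%N by apply: leq_ltn_trans Vm; move: h1 h2; clear; nia.
  by move: h3; rewrite ltn_pmul2r //; clear; lia.
have logV : (#|V| < 2 ^ l.-1)%N by apply: trunc_log_ltn.
have log2V : (2 * #|V| <= 2 ^ l)%N by rewrite /l expnS leq_mul2l /= ltnW.
have hV : (2 * #|V| ^ 2 < 2 ^ (2 * E))%N.
  apply: (@leq_trans (2 ^ (2 * l))); last by rewrite leq_exp2l // leq_mul2l lE orbT.
  rewrite (mul2n l) -addnn expnD -mulnn mulnA.
  apply: leq_ltn_trans (leq_mul log2V (leqnn _)) _; rewrite ltn_pmul2l ?expn_gt0 //.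
  by apply: leq_trans logV _; rewrite leq_exp2l // leq_pred.
have malpha' : m%:R <= alpha * #|V|%:R by apply: le_trans malpha _; nra.
have mVle : (m <= #|V|)%N by apply: leq_trans mEV; apply: leq_addr.
have [phi [X [phiE uX Xc Xd abs]]] :=
  absorbers_exist sg pa m0 mVle alphaP malpha' degV qP hk hV.
(* Then [expR (lambda * (a' / 2))] is the [l]-th power of e, which exceeds [2 ^ l] and hence the
   number [2 * #|V|] of summands. *)
pose lambda : R := 2 * l%:R / a'.
have lambda0 : 0 < lambda by rewrite divr_gt0 // mulr_gt0 //; lra.
have KR : K%:R = k0%:R * l%:R :> R by rewrite natrM.
have h4 : 12 * B%:R * K%:R ^+ 2 < eta * C%:R * E%:R.
  have eC : 0 < eta * C%:R by rewrite mulr_gt0 //; lra.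
  have h : n1.+1%:R * l%:R ^+ 2 <= E%:R :> R by apply: N0l2.
  apply: lt_le_trans (ler_wpM2l (ltW eC) h).
  have l20 : 0 < l%:R ^+ 2 :> R by rewrite exprn_gt0 //; lra.
  have h' : 12 * B%:R * k0%:R ^+ 2 < eta * C%:R * n1.+1%:R.
    rewrite [eta * C%:R * _]mulrC -ltr_pdivrMr //.
    by apply: le_lt_trans n1P _; rewrite ltr_nat.
  have -> : 12 * B%:R * K%:R ^+ 2 = 12 * B%:R * k0%:R ^+ 2 * l%:R ^+ 2 :> R.
    by rewrite KR; ring.
  by rewrite [ltRHS]mulrA ltr_pM2r.
have h5 : lambda * K%:R <= 2^-1 * E%:R.
  have h : n2%:R * l%:R ^+ 2 <= E%:R :> R by apply: N0l2.
  have -> : lambda * K%:R = 2^-1 * (4 * k0%:R / a' * l%:R ^+ 2).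
    by rewrite /lambda KR; field; rewrite gt_eqF.
  rewrite ler_pM2l ?invr_gt0 //; apply: le_trans h; apply: ler_wpM2r n2P.
  by rewrite exprn_ge0.
have rootK : 3 * walk_cost gamma Delta J * (Delta * (trunc_log 2 #|V|).+1)%:R <= eta * K%:R.
  rewrite -/W natrM mulrA KR [eta * _]mulrA; apply: ler_pM => //.
    by rewrite !mulr_ge0.
  by rewrite ler_nat.
have rate : #|V|%:R * (eta / E%:R + 2 * lambda * K%:R / E%:R ^+ 2) <= a' / 2.
  have VE2 : #|V|%:R / E%:R <= 2 * c1%:R :> R.
    rewrite ler_pdivrMr // -!natrM ler_nat; apply: leq_trans (ltnW VE) _.
    by rewrite -mulnA [(c1 * E)%N]mulnC mulnA leq_mul2r; apply/orP; right; move: E0; clear; lia.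
  have h : n3%:R * l%:R ^+ 2 <= E%:R :> R by apply: N0l2.
  have h6 : 32 * c1%:R * k0%:R / a' ^+ 2 * l%:R ^+ 2 <= E%:R.
    by apply: le_trans h; apply: ler_wpM2r n3P; rewrite exprn_ge0.
  have h7 : lambda * K%:R / E%:R <= a' / (16 * c1%:R).
    rewrite ler_pdivrMr //.
    have c1p : 0 < c1%:R :> R by lra.
    have -> : lambda * K%:R = a' / (16 * c1%:R) * (32 * c1%:R * k0%:R / a' ^+ 2 * l%:R ^+ 2).
      by rewrite /lambda KR; field; rewrite !gt_eqF.
    by rewrite ler_pM2l // divr_gt0 // mulr_gt0.
  have -> : #|V|%:R * (eta / E%:R + 2 * lambda * K%:R / E%:R ^+ 2) =
      #|V|%:R / E%:R * (eta + 2 * (lambda * K%:R / E%:R)).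
    by field; rewrite gt_eqF.
  apply: (@le_trans _ _ (2 * c1%:R * (eta + 2 * (a' / (16 * c1%:R))))); last first.
    rewrite le_eqVlt; apply/orP; left; apply/eqP; rewrite /eta; field.
    by rewrite gt_eqF //; lra.
  apply: ler_pM VE2 _; first by rewrite divr_ge0.
    by rewrite addr_ge0 ?(ltW eta0) // !mulr_ge0 ?invr_ge0 // ltW.
  by rewrite lerD2l ler_pM2l.
have start : 2 * #|V|%:R <= expR (lambda * (a' / 2)).
  have -> : lambda * (a' / 2) = l%:R * 1 by rewrite /lambda; field; rewrite gt_eqF.
  rewrite expRM_natl; apply: (@le_trans _ _ (2 ^+ l)).
    by rewrite -natrX -natrM ler_nat.
  by apply: lerXn2r; rewrite ?nnegrE ?expR_ge0 //; apply: le_trans (expR_ge1Dx 1).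
(* Fewer than [E + K <= 2 * E] vertices remain after [T] epochs, no more than there are absorbers
   per triple. *)
pose T := ((#|V| - (m + E)) %/ K)%N.
have TK : (T * K <= #|V| - (m + E))%N := leq_trunc_div _ _.
have TK' : (#|V| - (m + E) < T.+1 * K)%N by rewrite ltn_ceil.
have mT : (m + T * K + E <= #|V|)%N by move: TK mEV; clear; lia.
have dens s x : 2^-1 + a + a' <= density R g m phi s x.
  rewrite /density (card_free phiE) natrB //.
  have h6 : #|nbhd g s x|%:R - m%:R <= #|nbhd g s x :&: free m phi|%:R :> R.
    rewrite lerBlDr -natrD ler_nat -(cardsID (free m phi) (nbhd g s x)) leq_add2l.
    apply: (@leq_trans #|img m phi|); last by rewrite card_img //; case: phiE.
    by apply: subset_leq_card; apply/subsetP => z; rewrite /free in_setD in_setC negbK => /andP[].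
  have h7 := degV s x; have Vm0 : 0 < #|V|%:R - m%:R :> R by nra.
  rewrite ler_pdivlMr //; apply: le_trans h6; rewrite /a /a'; nra.
have [psi psiE psi_phi] := almost_spanning pa a0 aC aB eta0 eta1 lambda0 K0 E0 h4 h5
  gammaJ rootK m0 mT phiE dens rate start.
apply: (absorb_all pa m0 mVle _ _ uX Xc Xd abs psiE psi_phi).
  by rewrite leq_addr /= (leq_trans _ mT) // leq_addr.
have arith (v w e y x : nat) : (v - (w + e) < y + x -> y <= e -> w + e <= v ->
    v - (w + x) <= 2 * e)%N by clear; lia.
by apply: arith KE mEV; rewrite -mulSn.
Qed.

(** * From parent arrays back to oriented trees *)

Lemma min_semidegree_le (V : finType) (g : rel V) s x :
  (min_semidegree g <= #|nbhd g s x|)%N.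
Proof.
apply: (@leq_trans (minn (outdeg g x) (indeg g x))); last by case: s; rewrite ?geq_minl ?geq_minr.
rewrite /min_semidegree; have := mem_index_enum x.
elim: (index_enum V) => //= y r IH; rewrite inE big_cons => /predU1P[->|/IH]; first exact: geq_minl.
exact/leq_trans/geq_minr.
Qed.

Lemma embeds_contains (V W : finType) (g : rel V) (t : rel W) (w : nat -> W)
    (pi : nat -> nat) (sg : nat -> bool) (theta : nat -> V) :
  (forall x, exists2 i, (i < #|W|)%N & w i = x) ->
  (forall i j, (i < #|W|)%N -> (j < #|W|)%N -> t (w i) (w j) ->
    [/\ (0 < j)%N, pi j = i & sg j] \/ [/\ (0 < i)%N, pi i = j & ~~ sg i]) ->
  embeds g pi sg #|W| theta -> contains g t.
Proof.
move=> w_onto t_edge [inj edges].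
have w_ex x : exists i, (i < #|W|)%N && (w i == x).
  by have [i iW <-] := w_onto x; exists i; rewrite iW eqxx.
pose idx x := xchoose (w_ex x).
have idxP x : (idx x < #|W|)%N /\ w (idx x) = x.
  by have /andP[lt /eqP] := xchooseP (w_ex x).
pose f x := theta (idx x).
have f_inj : injective f.
  move=> x y /inj e; have [ix <-] := idxP x; have [iy <-] := idxP y.
  by rewrite (e ix iy).
(* The subdigraph keeps only the images of tree edges; [g] may have further edges between these
   vertices. *)
exists [set f x | x : W], (fun u v => [exists x, exists y, [&& f x == u, f y == v & t x y]]).
split=> [u v /existsP[x /existsP[y /and3P[/eqP<- /eqP<- txy]]]|].
  split; rewrite ?imset_f //; have [ix wx] := idxP x; have [iy wy] := idxP y.
  rewrite /f; have := t_edge _ _ ix iy; rewrite wx wy => /(_ txy).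
  move=> [[j0 pj sj]|[j0 pj sj]].
    by have := edges (idx y); rewrite j0 iy pj sj; apply.
  by have := edges (idx x); rewrite j0 ix pj (negbTE sj); apply.
exists f; split=> // x y; apply/existsP/idP => [[x' /existsP[y' /and3P[/eqP/f_inj-> /eqP/f_inj->]]]//|txy].
by exists x; apply/existsP; exists y; rewrite !eqxx.
Qed.

Unset Implicit Arguments.

Theorem theorem1p2 (R : realType) (Delta : nat) (alpha : R)
    (alpha_gt0 : 0 < alpha) :
  exists n0 : nat,
    forall (n : nat) (V : finType) (g : rel V),
      (n0 <= n)%N -> digraph g -> #|V| = n ->
      (2^-1 + alpha) * n%:R <= (min_semidegree g)%:R ->
      forall (W : finType) (t : rel W),
        oriented_tree t -> #|W| = n ->
        (max_degree (underlying t) <= Delta)%N ->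
        contains g t.
Proof.
(* The constants are chosen for a surplus of at most 1/2; lowering alpha only weakens the degree
   condition. *)
pose beta := Num.min alpha 2^-1.
have betaP : 0 < beta <= 2^-1 by rewrite lt_min alpha_gt0 invr_gt0 ltr0n ge_min lexx orbT.
have [n0 n0P] := parent_array_embeds Delta betaP.
exists n0 => n V g n0n _ Vn degg W t treet Wn degt.
have [w [pi [sg [_ w_onto pa t_edge]]]] := oriented_tree_parent_array treet degt.
rewrite Wn -Vn in pa.
have [||theta thetaE] := n0P V g pi sg _ _ pa; first by rewrite Vn.
  move=> s x; rewrite Vn; apply: (@le_trans _ _ ((2^-1 + alpha) * n%:R)).
    by apply: ler_wpM2r => //; rewrite lerD2l ge_min lexx.
  by apply: le_trans degg _; rewrite ler_nat min_semidegree_le.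
apply: (embeds_contains w_onto t_edge (theta := theta)).
by rewrite Wn -Vn.
Qed.
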